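(* Let $X$ be a real Banach space. (a) If $X=c_0$, then $\mathrm{BS}(X,\mathbb{R}) \subsetneqq \mathrm{BS}_a(X,\mathbb{R}) = \mathrm{NA}(X,\mathbb{R})$. (b) If $X=L_1[0,1]$ or $X=C[0,1]$, then $\mathrm{BS}(X,\mathbb{R}) \subsetneqq \mathrm{BS}_a(X,\mathbb{R}) \subsetneqq \mathrm{NA}(X,\mathbb{R})$. (c) If $X$ is non-reflexive and $X^*$ is strictly convex, then $\mathrm{BS}(X,\mathbb{R}) = \mathrm{BS}_a(X,\mathbb{R}) \subsetneqq \mathcal{L}(X,\mathbb{R})$.
   Context: All Banach spaces are real. $S_X$ is the unit sphere of $X$, $X^*$ its dual, and $\mathcal{L}(X,Y)$ is the space of bounded linear operators from $X$ to $Y$ with the operator norm, so $\mathcal{L}(X,\mathbb{R})=X^*$. For $T\in\mathcal{L}(X,Y)$ put $M_T=\{x\in S_X:\|Tx\|=\|T\|\}$; $T$ attains its norm if $M_T\neq\emptyset$, and $\mathrm{NA}(X,Y)$ is the set of norm attaining operators. For vectors $x,y$ of a Banach space: $x\perp_B y$ (Birkhoff-James orthogonality) means $\|x\|\le\|x+\lambda y\|$ for all $\lambda\in\mathbb{R}$; $x\perp_S y$ (strong Birkhoff-James orthogonality) means $\|x\|<\|x+\lambda y\|$ for all $\lambda\in\mathbb{R}\setminus\{0\}$. $\mathrm{BS}(X,Y)$ (operators with the Bhatia-Šemrl property) is the set of $T\in\mathrm{NA}(X,Y)$ such that for every $S\in\mathcal{L}(X,Y)$ with $T\perp_B S$ there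 is $x_0\in M_T$ with $Tx_0\perp_B Sx_0$. $\mathrm{BS}_a(X,Y)$ (operators with the adjusted Bhatia-Šemrl property) is the set of $T\in\mathrm{NA}(X,Y)$ such that for every $S\in\mathcal{L}(X,Y)$ with $T\perp_S S$ there is $x_0\in M_T$ with $Tx_0\perp_B Sx_0$. *)

(* Defs.v *)
From HB Require Import structures.
From mathcomp Require Import all_boot all_order all_algebra.
From mathcomp Require Import all_classical all_reals all_analysis.
From mathcomp Require Import measurable_realfun ess_sup_inf.

Set Implicit Arguments.
Unset Strict Implicit.
Unset Printing Implicit Defensive.

Import Order.TTheory GRing.Theory Num.Theory.
Import numFieldNormedType.Exports.

Local Open Scope classical_set_scope.
Local Open Scope ring_scope.

Section sup_norm.
Context (R : realType) (T : Type) (V : normedModType R).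
Implicit Types (A : set T) (f g : T -> V).

Definition sup_norm A f : R := sup [set `|f t| | t in A].

Lemma sup_norm_le A f M : A !=set0 ->
  (forall t, A t -> `|f t| <= M) -> sup_norm A f <= M.
Proof.
move=> [t At] fM; apply: ge_sup; first by exists `|f t|, t.
by move=> _ [s As <-]; exact: fM.
Qed.

Lemma sup_norm_ge A f t :
  (exists M, forall t, A t -> `|f t| <= M) -> A t -> `|f t| <= sup_norm A f.
Proof.
move=> [M fM] At; apply: ub_le_sup; last by exists t.
by exists M => _ [s As <-]; exact: fM.
Qed.

Lemma sup_normD A f g : A !=set0 ->
  (exists M, forall t, A t -> `|f t| <= M) ->
  (exists M, forall t, A t -> `|g t| <= M) ->
  sup_norm A (f + g) <= sup_norm A f + sup_norm A g.
Proof.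
move=> A0 bf bg; apply: sup_norm_le => // t At.
by rewrite (le_trans (ler_normD _ _))// lerD// sup_norm_ge.
Qed.

Lemma sup_normZ A f (l : R) : A !=set0 ->
  (exists M, forall t, A t -> `|f t| <= M) ->
  sup_norm A (l *: f) = `|l| * sup_norm A f.
Proof.
move=> A0 [M fM]; apply/eqP; rewrite eq_le; apply/andP; split.
  apply: sup_norm_le => // t At /=.
  by rewrite normrZ ler_wpM2l// sup_norm_ge//; exists M.
have [->|l0] := eqVneq l 0.
  rewrite normr0 mul0r; case: A0 => t At.
  apply: (le_trans (normr_ge0 ((0 *: f) t))).
  apply: sup_norm_ge => //; exists 0 => s _.
  by rewrite (_ : (0 *: f) s = 0 *: f s)// scale0r normr0.
rewrite -ler_pdivlMl ?normr_gt0//; apply: sup_norm_le => // t At.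
rewrite ler_pdivlMl ?normr_gt0// -normrZ.
apply: (@sup_norm_ge _ (l *: f)) => //; exists (`|l| * M) => s As.
by rewrite normrZ ler_wpM2l// fM.
Qed.

Lemma sup_norm_eq0 A f : (exists M, forall t, A t -> `|f t| <= M) ->
  sup_norm A f = 0 -> forall t, A t -> f t = 0.
Proof.
move=> bf f0 t At; apply/normr0_eq0/eqP.
by rewrite eq_le normr_ge0 andbT -f0 sup_norm_ge.
Qed.

End sup_norm.

Section bounded_operators.
Context (R : realType) (X Y : normedModType R).

Definition is_bounded_operator : {pred X -> Y} :=
  mem [set T : X -> Y | linear T /\ bounded_near T (nbhs (0 : X))].

Record bounded_operator := BoundedOperator {
  bounded_operator_fun :> X -> Y;
  _ : bounded_operator_fun \in is_bounded_operator
}.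

HB.instance Definition _ := [isSub for bounded_operator_fun].
HB.instance Definition _ := [Choice of bounded_operator by <:].

Lemma is_bounded_operatorP (T : X -> Y) : T \in is_bounded_operator <->
  linear T /\ exists M, forall x, `|T x| <= M * `|x|.
Proof.
split=> [/set_mem[lT bT]|[lT [M bT]]].
  split=> //.
  pose L := GRing.isLinear.Build R X Y *:%R T lT.
  pose T' : {linear X -> Y} := HB.pack T L.
  have /linear_boundedP/pinfty_ex_gt0[M _ TM] : bounded_near T' (nbhs (0 : X)).
    by [].
  by exists M.
apply/mem_set; split=> //.
apply/ex_bound; exists `|M|; apply/nbhs_norm0P; exists 1 => //= x /= x1.
rewrite (le_trans (bT x))// (le_trans (ler_norm _))// normrM normr_id.
by rewrite ler_piMr// ltW.
Qed.

Lemma bounded_operator_linear (T : bounded_operator) : linear T.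
Proof. by case/is_bounded_operatorP: (valP T). Qed.

HB.instance Definition _ (T : bounded_operator) :=
  GRing.isLinear.Build R X Y *:%R T (bounded_operator_linear T).

Lemma is_bounded_operator_submod_closed : submod_closed is_bounded_operator.
Proof.
split.
  apply/is_bounded_operatorP; split; first by move=> a x y /=; rewrite scaler0 addr0.
  by exists 0 => x; rewrite normr0 mul0r.
move=> a f g /is_bounded_operatorP[lf [M fM]] /is_bounded_operatorP[lg [N gN]].
apply/is_bounded_operatorP; split.
  move=> b x y; have E z : (a *: f + g) z = a *: f z + g z by [].
  by rewrite !E lf lg !scalerDr !scalerA (mulrC a b) addrACA.
exists (`|a| * M + N) => x; rewrite (le_trans (ler_normD _ _))//.
by rewrite mulrDl lerD// normrZ -mulrA ler_wpM2l.
Qed.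

HB.instance Definition _ := GRing.isSubmodClosed.Build _ _ is_bounded_operator
  is_bounded_operator_submod_closed.
HB.instance Definition _ :=
  [SubChoice_isSubLmodule of bounded_operator by <:].

Definition operator_norm (T : bounded_operator) : R :=
  sup_norm [set x | `|x| <= 1] T.

Let ball0 : [set x : X | `|x| <= 1] !=set0.
Proof. by exists 0; rewrite /= normr0 ler01. Qed.

Let operator_ball (T : bounded_operator) :
  exists M, forall x, `|x| <= 1 -> `|T x| <= M.
Proof.
have /is_bounded_operatorP[_ [M TM]] := valP T.
exists `|M| => x x1; rewrite (le_trans (TM x))// (le_trans (ler_norm _))//.
by rewrite normrM normr_id ler_piMr.
Qed.

Let operator_normD (S T : bounded_operator) :
  operator_norm (S + T) <= operator_norm S + operator_norm T.
Proof. exact: sup_normD. Qed.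

Let operator_normZ (l : R) (T : bounded_operator) :
  operator_norm (l *: T) = `|l| * operator_norm T.
Proof. exact: sup_normZ. Qed.

Let operator_norm_eq0 (T : bounded_operator) : operator_norm T = 0 -> T = 0.
Proof.
move=> /(sup_norm_eq0 (operator_ball T)) T0; apply/val_inj/funext => x /=.
have [->|x0] := eqVneq x 0; first exact: linear0.
have xn0 : `|x|^-1 != 0 by rewrite invr_neq0// normr_eq0.
apply: (scalerI xn0); rewrite scaler0 -[LHS]linearZ.
by apply: T0; rewrite /= normfZV.
Qed.

HB.instance Definition _ := @Lmodule_isNormed.Build R bounded_operator
  operator_norm operator_normD operator_normZ operator_norm_eq0.

End bounded_operators.

Notation "''L' ( X , Y )" := (bounded_operator X Y)
  (at level 8, format "''L' ( X ,  Y )") : type_scope.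


Section operators.
Context (R : realType) (X Y : normedModType R).
Implicit Types T S : 'L(X, Y).

Definition norm_attainment_set T : set X :=
  [set x | `|x| = 1 /\ `|T x| = `|T|].

Definition NA : set 'L(X, Y) := [set T | norm_attainment_set T !=set0].

End operators.

Section Birkhoff_James.
Context (R : realType) (V : normedModType R).
Implicit Types x y : V.

Definition BJ_orthogonal x y := forall l : R, `|x| <= `|x + l *: y|.

Definition strong_BJ_orthogonal x y :=
  forall l : R, l != 0 -> `|x| < `|x + l *: y|.

End Birkhoff_James.

Section Bhatia_Semrl.
Context (R : realType) (X Y : normedModType R).

Definition BS : set 'L(X, Y) :=
  [set T | NA T /\ forall S : 'L(X, Y), BJ_orthogonal T S ->
     exists2 x, norm_attainment_set T x & BJ_orthogonal (T x) (S x)].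

Definition BSa : set 'L(X, Y) :=
  [set T | NA T /\ forall S : 'L(X, Y), strong_BJ_orthogonal T S ->
     exists2 x, norm_attainment_set T x & BJ_orthogonal (T x) (S x)].

End Bhatia_Semrl.

Arguments NA {R} X Y.
Arguments BS {R} X Y.
Arguments BSa {R} X Y.

Definition strictly_convex (R : realType) (V : normedModType R) :=
  forall x y : V, `|x| = 1 -> `|y| = 1 -> x != y -> `|2^-1 *: (x + y)| < 1.

Section reflexivity.
Context (R : realType) (X : normedModType R).

Lemma operator_norm_le (T : 'L(X, R)) x : `|T x| <= `|T| * `|x|.
Proof.
have [->|x0] := eqVneq x 0; first by rewrite linear0 !normr0 mulr0.
have xn0 : 0 < `|x| by rewrite normr_gt0.
rewrite -ler_pdivrMr// mulrC.
have -> : `|x|^-1 * `|T x| = `|T (`|x|^-1 *: x)|.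
  by rewrite linearZ normrZ normrV ?unitfE ?gt_eqF// normr_id.
apply: sup_norm_ge; last by rewrite /= normfZV.
have /is_bounded_operatorP[_ [M TM]] := valP T.
exists `|M| => z z1; rewrite (le_trans (TM z))// (le_trans (ler_norm _))//.
by rewrite normrM normr_id ler_piMr.
Qed.

Fact evaluation_subproof (x : X) :
  (fun f : 'L(X, R) => f x) \in @is_bounded_operator R 'L(X, R) R.
Proof.
apply/is_bounded_operatorP; split=> //.
by exists `|x| => f; rewrite mulrC operator_norm_le.
Qed.

Definition canonical_embedding (x : X) : 'L('L(X, R), R) :=
  BoundedOperator (evaluation_subproof x).

Definition reflexive_space := range canonical_embedding = setT.

End reflexivity.

Section c0.
Context (R : realType).

Definition is_c0 : {pred nat -> R} := mem [set u : nat -> R | u @ \oo --> 0].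

Record c0 := C0 { c0_seq :> nat -> R; _ : c0_seq \in is_c0 }.

HB.instance Definition _ := [isSub for c0_seq].
HB.instance Definition _ := [Choice of c0 by <:].

Lemma is_c0_submod_closed : submod_closed is_c0.
Proof.
split; first by apply/mem_set; exact: cvg_cst.
move=> a u v /set_mem u0 /set_mem v0; apply/mem_set => /=.
rewrite -[0](addr0 0) -{1}(scaler0 R a).
by apply: cvgD => //; apply: cvgZr.
Qed.

HB.instance Definition _ :=
  GRing.isSubmodClosed.Build _ _ is_c0 is_c0_submod_closed.
HB.instance Definition _ := [SubChoice_isSubLmodule of c0 by <:].

Definition c0_norm (u : c0) : R := sup_norm [set: nat] u.

Let setT0 : [set: nat] !=set0. Proof. by exists 0%N. Qed.

Let c0_bounded (u : c0) : exists M, forall n, [set: nat] n -> `|u n| <= M.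
Proof.
have /set_mem/= u0 := valP u.
have /cvg_seq_bounded : cvgn (u : nat -> R) by apply/cvg_ex; exists 0.
by move=> /pinfty_ex_gt0[M _ uM]; exists M => n _; exact: uM.
Qed.

Let c0_normD (u v : c0) : c0_norm (u + v) <= c0_norm u + c0_norm v.
Proof. exact: sup_normD. Qed.

Let c0_normZ (l : R) (u : c0) : c0_norm (l *: u) = `|l| * c0_norm u.
Proof. exact: sup_normZ. Qed.

Let c0_norm_eq0 (u : c0) : c0_norm u = 0 -> u = 0.
Proof.
move=> /(sup_norm_eq0 (c0_bounded u)) u0.
by apply/val_inj/funext => n; exact: u0.
Qed.

HB.instance Definition _ :=
  @Lmodule_isNormed.Build R c0 c0_norm c0_normD c0_normZ c0_norm_eq0.

End c0.

Section C01.
Context (R : realType).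

Definition unit_interval : set R := `[0, 1].

Definition is_C01 : {pred unit_interval -> R} :=
  mem [set f : unit_interval -> R | continuous f].

Record C01 := MkC01 { C01_fun :> unit_interval -> R; _ : C01_fun \in is_C01 }.

HB.instance Definition _ := [isSub for C01_fun].
HB.instance Definition _ := [Choice of C01 by <:].

Lemma is_C01_submod_closed : submod_closed is_C01.
Proof.
split; first by apply/mem_set => x; exact: cst_continuous.
move=> a f g /set_mem cf /set_mem cg; apply/mem_set => x.
exact: (cvgD (@cvgZl_tmp R R _ (nbhs x) _ a f _ (cf x)) (cg x)).
Qed.

HB.instance Definition _ :=
  GRing.isSubmodClosed.Build _ _ is_C01 is_C01_submod_closed.
HB.instance Definition _ := [SubChoice_isSubLmodule of C01 by <:].

Definition C01_norm (f : C01) : R := sup_norm [set: unit_interval] f.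

Let setT0 : [set: unit_interval] !=set0.
Proof.
suff z : 0 \in unit_interval by exists (exist _ 0 z).
by apply/mem_set; rewrite /unit_interval/= in_itv/= lexx ler01.
Qed.

Let C01_bounded (f : C01) :
  exists M, forall t, [set: unit_interval] t -> `|f t| <= M.
Proof.
have /set_mem/= cf := valP f.
move/subspace_valL_continuousP : cf => /continuous_compact cf.
have /cf : compact unit_interval by exact: segment_compact.
move=> /compact_bounded/pinfty_ex_gt0[M _ fM]; exists M => t _.
have := fM (f t); apply; exists (val t); first exact: set_mem (valP t).
by have /(congr1 (@^~ t)) := valLK point (f : unit_interval -> R).
Qed.

Let C01_normD (f g : C01) : C01_norm (f + g) <= C01_norm f + C01_norm g.
Proof. exact: sup_normD. Qed.

Let C01_normZ (l : R) (f : C01) : C01_norm (l *: f) = `|l| * C01_norm f.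
Proof. exact: sup_normZ. Qed.

Let C01_norm_eq0 (f : C01) : C01_norm f = 0 -> f = 0.
Proof.
move=> /(sup_norm_eq0 (C01_bounded f)) f0.
by apply/val_inj/funext => t; exact: f0.
Qed.

HB.instance Definition _ :=
  @Lmodule_isNormed.Build R C01 C01_norm C01_normD C01_normZ C01_norm_eq0.

End C01.

Arguments unit_interval : clear implicits.

(* The library has no algebraic structure on LspaceType, whose elements are
   almost-everywhere classes: operations go through representatives. *)
Section Lspace_normedMod.
Context d (T : measurableType d) (R : realType).
Context (mu : {measure set T -> \bar R}) (p : \bar R) (p1 : (1 <= p)%E).

HB.instance Definition _ := gen_eqMixin (LspaceType mu p1).
HB.instance Definition _ := gen_choiceMixin (LspaceType mu p1).

Lemma Lnorm_ae_eq (f g : T -> R) : measurable_fun setT f ->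
  measurable_fun setT g -> f = g %[ae mu] ->
  ('N[mu]_p[EFin \o f] = 'N[mu]_p[EFin \o g])%E.
Proof.
move=> mf mg fg; have mp r (h : T -> R) : measurable_fun [set: T] h ->
    measurable_fun [set: T] (fun x => `|(EFin \o h) x| `^ r)%E.
  move=> mh; apply: (@measurableT_comp _ _ _ _ _ _ (fun x => x `^ r)%E) => //=.
    exact: (measurableT_comp (measurable_poweR _)).
  by apply/measurable_EFinP; exact: measurableT_comp.
rewrite unlock /Lnorm; case: p p1 => [r r1||//]; last first.
  move=> _; case: ifPn => // _; apply: eq_ess_sup.
  by apply: filterS fg => x /= ->.
congr poweR; apply: ge0_ae_eq_integral => //.
- exact: (mp r f mf).
- exact: (mp r g mg).
- by move=> x _; exact: poweR_ge0.
- by move=> x _; exact: poweR_ge0.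
- by apply: filterS fg => x /= + _ => ->.
Qed.
Let Lspace_repr_subproof (F : LspaceType mu p1) : (F : T -> R) \in Lfun mu p.
Proof.
rewrite inE; apply/andP; split.
  by apply/mem_set; exact: (@measurable_funPT _ _ _ _ (repr (F : {mfun_ mu, T >-> measurableTypeR R}))).
by rewrite inE; exact: Lebesgue_finite.
Qed.

Definition Lspace_repr (F : LspaceType mu p1) : LfunType mu p1 :=
  Lfun_Sub p1 (Lspace_repr_subproof F).



Let mfun_class_subproof (f : LfunType mu p1) :
  (f : T -> measurableTypeR R) \in @mfun _ _ T (measurableTypeR R).
Proof. by apply/mem_set; exact: (@measurable_funPT _ _ _ _ f). Qed.

Definition mfun_class (f : LfunType mu p1) :
    {mfun_ mu, T >-> measurableTypeR R} :=
  (\pi_({mfun_ mu, T >-> measurableTypeR R}) (mfun_Sub (mfun_class_subproof f)))%qT.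

Let mfun_measurable (F : {mfun_ mu, T >-> measurableTypeR R}) :
  measurable_fun [set: T] (F : T -> R).
Proof. exact: (@measurable_funPT _ _ _ _ (repr F)). Qed.

Let Lfun_measurable (f : LfunType mu p1) : measurable_fun [set: T] (f : T -> R).
Proof. exact: (@measurable_funPT _ _ _ _ f). Qed.

Lemma mfun_class_ae f : (mfun_class f : T -> R) = f %[ae mu].
Proof.
have /eqP := reprK (mfun_class f).
by rewrite {2}/mfun_class eqmodE => /asboolP.
Qed.

Fact mfun_class_finite (f : LfunType mu p1) : finite_norm mu p (mfun_class f).
Proof.
rewrite /finite_norm (Lnorm_ae_eq _ _ (mfun_class_ae f)) //.
exact: Lfunction_finite.
Qed.

Definition Lspace_class (f : LfunType mu p1) : LspaceType mu p1 :=
  HB.pack_for (LspaceType mu p1) (mfun_class f)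
    (isFinLebesgue.Build _ _ _ _ _ p1 (mfun_class f) (mfun_class_finite f)).

Lemma Lspace_class_ae f : (Lspace_class f : T -> R) = f %[ae mu].
Proof. exact: mfun_class_ae. Qed.

Lemma Lspace_ae_eqP (F G : LspaceType mu p1) :
  (F : T -> R) = G %[ae mu] <-> F = G.
Proof.
split=> [FG|->]; last by apply: nearW.
have : (F : {mfun_ mu, T >-> measurableTypeR R}) = G.
  rewrite -[LHS]reprK -[RHS]reprK; apply/eqP; rewrite eqmodE.
  exact/asboolP.
case: F G {FG} => [F [[fF]]] [G [[fG]]] /= FG; subst G.
by rewrite (bool_irrelevance fF fG).
Qed.

Let addL (F G : LspaceType mu p1) :=
  Lspace_class (Lspace_repr F + Lspace_repr G).
Let oppL (F : LspaceType mu p1) := Lspace_class (- Lspace_repr F).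
Let zeroL : LspaceType mu p1 := Lspace_class 0.
Let scaleL (a : R) (F : LspaceType mu p1) := Lspace_class (a *: Lspace_repr F).

Let addLE F G : {ae mu, forall x, (addL F G : T -> R) x = (F : T -> R) x + (G : T -> R) x}.
Proof. by apply: filterS (Lspace_class_ae (Lspace_repr F + Lspace_repr G)) => x /(_ I). Qed.

Let oppLE F : {ae mu, forall x, (oppL F : T -> R) x = - (F : T -> R) x}.
Proof. by apply: filterS (Lspace_class_ae (- Lspace_repr F)) => x /(_ I). Qed.

Let zeroLE : {ae mu, forall x, (zeroL : T -> R) x = 0}.
Proof. by apply: filterS (Lspace_class_ae 0) => x /(_ I). Qed.

Let scaleLE a F : {ae mu, forall x, (scaleL a F : T -> R) x = a * (F : T -> R) x}.
Proof. by apply: filterS (Lspace_class_ae (a *: Lspace_repr F)) => x /(_ I). Qed.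

Let Lspace_ext (F G : LspaceType mu p1) :
  {ae mu, forall x, (F : T -> R) x = (G : T -> R) x} -> F = G.
Proof. by move=> FG; apply/Lspace_ae_eqP; apply: filterS FG => x. Qed.

Let addLA : associative addL.
Proof.
move=> F G H; apply: Lspace_ext; near=> x.
rewrite (near (addLE F (addL G H)) x)// (near (addLE G H) x)//.
by rewrite (near (addLE (addL F G) H) x)// (near (addLE F G) x)// addrA.
Unshelve. all: by end_near. Qed.

Let addLC : commutative addL.
Proof.
move=> F G; apply: Lspace_ext; near=> x.
by rewrite (near (addLE F G) x)// (near (addLE G F) x)// addrC.
Unshelve. all: by end_near. Qed.

Let add0L : left_id zeroL addL.
Proof.
move=> F; apply: Lspace_ext; near=> x.
by rewrite (near (addLE zeroL F) x)// (near zeroLE x)// add0r.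
Unshelve. all: by end_near. Qed.

Let addNL : left_inverse zeroL oppL addL.
Proof.
move=> F; apply: Lspace_ext; near=> x.
rewrite (near (addLE (oppL F) F) x)// (near (oppLE F) x)// (near zeroLE x)//.
by rewrite addNr.
Unshelve. all: by end_near. Qed.

HB.instance Definition _ :=
  GRing.isZmodule.Build (LspaceType mu p1) addLA addLC add0L addNL.

Let scaleLA a b F : scaleL a (scaleL b F) = scaleL (a * b) F.
Proof.
apply: Lspace_ext; near=> x.
rewrite (near (scaleLE a (scaleL b F)) x)// (near (scaleLE b F) x)//.
by rewrite (near (scaleLE (a * b) F) x)// mulrA.
Unshelve. all: by end_near. Qed.

Let scale1L : left_id 1 scaleL.
Proof.
move=> F; apply: Lspace_ext; near=> x.
by rewrite (near (scaleLE 1 F) x)// mul1r.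
Unshelve. all: by end_near. Qed.

Let scaleLDr : right_distributive scaleL addL.
Proof.
move=> a F G; apply: Lspace_ext; near=> x.
rewrite (near (scaleLE a (addL F G)) x)// (near (addLE F G) x)//.
rewrite (near (addLE (scaleL a F) (scaleL a G)) x)// mulrDr.
by rewrite (near (scaleLE a F) x)// (near (scaleLE a G) x).
Unshelve. all: by end_near. Qed.

Let scaleLDl F : {morph scaleL^~ F : a b / a + b >-> addL a b}.
Proof.
move=> a b; apply: Lspace_ext; near=> x.
rewrite (near (scaleLE (a + b) F) x)// mulrDl.
rewrite (near (addLE (scaleL a F) (scaleL b F)) x)//.
by rewrite (near (scaleLE a F) x)// (near (scaleLE b F) x).
Unshelve. all: by end_near. Qed.

HB.instance Definition _ := GRing.Zmodule_isLmodule.Build R (LspaceType mu p1)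
  scaleLA scale1L scaleLDr scaleLDl.

Definition Lspace_norm (F : LspaceType mu p1) : R :=
  fine 'N[mu]_p[EFin \o F].

Let Lspace_norm_class (f : LfunType mu p1) (F : LspaceType mu p1) :
  (F : T -> R) = f %[ae mu] -> Lspace_norm F = fine 'N[mu]_p[EFin \o f].
Proof. by move=> Ff; rewrite /Lspace_norm (Lnorm_ae_eq _ _ Ff). Qed.

Let Lspace_normD F G : Lspace_norm (F + G) <= Lspace_norm F + Lspace_norm G.
Proof.
rewrite (Lspace_norm_class (Lspace_class_ae (Lspace_repr F + Lspace_repr G))).
exact: ler_LnormD.
Qed.

Let Lspace_normZ a F : Lspace_norm (a *: F) = `|a| * Lspace_norm F.
Proof.
rewrite (Lspace_norm_class (Lspace_class_ae (a *: Lspace_repr F))).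
have -> : Lspace_norm F = fine 'N[mu]_p[EFin \o Lspace_repr F]%E by [].
by apply: EFin_inj; rewrite EFinM !finite_norm_fine; exact: LnormZ.
Qed.

Let Lspace_norm_eq0 F : Lspace_norm F = 0 -> F = 0.
Proof.
move=> /(@fine_Lnormr_eq0 _ _ _ _ _ _ (Lspace_repr F)) F0.
apply: Lspace_ext; near=> x; rewrite (near zeroLE x)//.
by move: (I); near: x; exact: F0.
Unshelve. all: by end_near. Qed.

HB.instance Definition _ := @Lmodule_isNormed.Build R (LspaceType mu p1)
  Lspace_norm Lspace_normD Lspace_normZ Lspace_norm_eq0.

End Lspace_normedMod.

Section L1_01.
Context (R : realType).

Lemma measurable_unit_interval :
  measurable (unit_interval R : set (measurableTypeR R)).
Proof. exact: measurable_itv. Qed.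

Definition lebesgue_measure01 := mrestr lebesgue_measure measurable_unit_interval.

HB.instance Definition _ := Measure.on lebesgue_measure01.

Definition L1_01 : normedModType R := LspaceType1 lebesgue_measure01.

End L1_01.

Arguments lebesgue_measure01 : clear implicits.

(* Main.v *)
Require Import Defs.
From mathcomp Require Import all_boot all_order all_algebra.
From mathcomp Require Import all_classical all_reals all_analysis.
From mathcomp Require Import measurable_realfun ring lra.

Set Implicit Arguments.
Unset Strict Implicit.
Unset Printing Implicit Defensive.

Import Order.TTheory GRing.Theory Num.Theory.
Import numFieldNormedType.Exports.
Local Open Scope classical_set_scope.
Local Open Scope ring_scope.

(* A functional f has the adjusted property as soon as the distance of u to the
   face {f = ||f||} of the unit sphere is at most K (||f|| - f u): this holds for
   every norm attaining f on c0 (which has finite support), for the evaluation at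
   0 on C[0,1] and for the integral on L1[0,1]. It fails to have the full
   property when some g has supremum 1 over the face without attaining it; test
   with g - f. The adjusted property fails for the sum of the
   2^-(n+1) delta_{1/(n+1)} on C[0,1], tested with delta_0, and for the integral
   against a weight equal to 1 exactly on the left half of [0,1], tested with the
   sign that is 1 on that half and -1 on the other.

   If X^* is strictly convex, Birkhoff-James orthogonality in X^* is already
   strong, up to trivial cases. It remains to find a functional that does not
   attain its norm (James). Strict convexity gives pointwise convergent
   subsequences of bounded sequences of functionals: arrange that all
   ultrafilter limits of a subsequence, and their midpoints, have the same norm.
   Non-reflexivity then gives a sequence f_n converging pointwise to some h that
   stays away from the midpoint combinations of the f_n, and a dyadic series of
   elements g_n - h, with g_n in the midpoint hull of a tail and the norms kept
   as small as possible, does not attain its norm. *)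

(** * Hahn-Banach theorem *)

Section Hahn_Banach.
Context (R : realType) (V : lmodType R).
Implicit Types (p q : V -> R) (x y : V).

Definition sublinear p :=
  (forall x y, p (x + y) <= p x + p y) /\
  (forall (t : R) x, 0 <= t -> p (t *: x) = t * p x).

Lemma sublinear0 p : sublinear p -> p 0 = 0.
Proof. by move=> [_ /(_ 0 0 (lexx 0))]; rewrite scale0r mul0r. Qed.

Lemma sublinear_geN p x : sublinear p -> - p (- x) <= p x.
Proof.
move=> sp; have := sp.1 x (- x); rewrite subrr sublinear0//; lra.
Qed.

(** An element [(v, r)] stands for the constraint [r <= g v] on the functional [g] sought. *)
Definition cone (A : set (V * R)) :=
  [/\ A (0, 0), (forall u v, A u -> A v -> A (u + v)) &
      forall t u, 0 <= t -> A u -> A (t *: u.1, t * u.2)].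

(** For constraints compatible with [p], this is the largest sublinear functional below [p] with
    value at most [- u.2] at [- u.1] for all [u] in [A]. A linear functional below it satisfies the
    constraints. *)
Definition cone_inf p (A : set (V * R)) x :=
  inf [set p (x + u.1) - u.2 | u in A].

Section cone_inf.
Context (p : V -> R) (A : set (V * R)).
Hypotheses (sp : sublinear p) (cA : cone A).
Hypothesis Ap : forall u, A u -> u.2 <= p u.1.

Let lb x u : A u -> - p (- x) <= p (x + u.1) - u.2.
Proof.
move=> Au; have := sp.1 (x + u.1) (- x); rewrite addrC addKr.
by have := Ap Au; lra.
Qed.

Let cone_inf_le x u : A u -> cone_inf p A x <= p (x + u.1) - u.2.
Proof.
move=> Au; apply: ge_inf; last by exists u.
by exists (- p (- x)) => _ [v Av <-]; exact: lb.
Qed.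

Let le_cone_inf x r : (forall u, A u -> r <= p (x + u.1) - u.2) ->
  r <= cone_inf p A x.
Proof.
move=> ru; apply: lb_le_inf; last by move=> _ [u Au <-]; exact: ru.
by case: cA => A0 _ _; exists (p (x + 0) - 0), (0, 0).
Qed.

Lemma cone_inf_bound u : A u -> cone_inf p A (- u.1) <= - u.2.
Proof.
move=> Au; rewrite (le_trans (cone_inf_le _ Au))//.
by rewrite addNr sublinear0// sub0r.
Qed.

Lemma cone_inf_leP x : cone_inf p A x <= p x.
Proof.
case: cA => A0 _ _; rewrite (le_trans (cone_inf_le x A0))//=.
by rewrite addr0 subr0.
Qed.

Let cone_inf_scale (t : R) x : 0 < t -> t * cone_inf p A x <= cone_inf p A (t *: x).
Proof.
move=> t0; apply: le_cone_inf => u Au.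
case: cA => _ _ cZ; have t'0 : 0 <= t^-1 by rewrite invr_ge0 ltW.
have := cone_inf_le x (cZ _ _ t'0 Au); rewrite -(ler_pM2l t0)/= => /le_trans; apply.
rewrite mulrBr mulVKf ?gt_eqF// -sp.2; last exact: ltW.
by rewrite scalerDr scalerA mulfV ?gt_eqF// scale1r.
Qed.

Lemma cone_inf_sublinear : sublinear (cone_inf p A).
Proof.
split=> [x y|t x].
  rewrite -lerBlDl; apply: le_cone_inf => v Av; rewrite lerBlDl -lerBlDr.
  apply: le_cone_inf => u Au; case: cA => _ cD _.
  have := cone_inf_le (x + y) (cD _ _ Au Av).
  have := sp.1 (x + u.1) (y + v.1); rewrite addrACA/=; lra.
rewrite le_eqVlt => /predU1P[<-|t0].
  rewrite scale0r mul0r; apply/eqP; rewrite eq_le; apply/andP; split.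
    by rewrite (le_trans (cone_inf_leP 0))// sublinear0.
  by apply: le_cone_inf => u Au; rewrite add0r subr_ge0 Ap.
(* The reverse inequality is the same bound at [t *: x] with the factor [t^-1]. *)
apply/eqP; rewrite eq_le cone_inf_scale// andbT.
rewrite -ler_pdivrMl// (le_trans (cone_inf_scale _ _)) ?invr_gt0//.
by rewrite scalerA mulVf ?gt_eqF// scale1r.
Qed.

End cone_inf.

(* A minimal sublinear functional is linear: lowering [q] along the ray of [y]
   gives a sublinear functional below [q], so nothing changes. *)
Lemma minimal_sublinear_linear q : sublinear q ->
  (forall q', sublinear q' -> (forall x, q' x <= q x) -> q' = q) ->
  forall a x y, q (a *: x + y) = a * q x + q y.
Proof.
move=> sq qmin.
have qD x y : q (x + y) = q x + q y.
  apply/eqP; rewrite eq_le sq.1/=.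
  pose A : set (V * R) := [set u | exists2 t, 0 <= t & u = (t *: y, t * q y)].
  have cA : cone A.
    split.
    - by exists 0 => //; rewrite scale0r mul0r.
    - move=> _ _ [s s0 ->] [t t0 ->]; exists (s + t); first exact: addr_ge0.
      by rewrite scalerDl mulrDl.
    - move=> t _ t0 [s s0 ->]; exists (t * s); first exact: mulr_ge0.
      by rewrite /= scalerA mulrA.
  have Aq u : A u -> u.2 <= q u.1 by move=> [t t0 ->] /=; rewrite sq.2.
  have /(congr1 (@^~ x)) := qmin _ (cone_inf_sublinear sq cA Aq) (cone_inf_leP sq cA Aq).
  move=> /= <-; rewrite -lerBrDr; apply: ge_inf; last first.
    by exists (y, q y) => //; exists 1; rewrite ?ler01// scale1r mul1r.
  exists (- q (- x)) => _ [u Au <-].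
  have := sq.1 (x + u.1) (- x); rewrite addrC addKr.
  by have := Aq _ Au; lra.
have qN x : q (- x) = - q x.
  by have := qD x (- x); rewrite subrr sublinear0//; lra.
move=> a x y; rewrite qD; congr (_ + _).
have [a0|a0] := leP 0 a; first exact: sq.2.
by rewrite -[a in LHS]opprK scaleNr qN sq.2 ?oppr_ge0 ?ltW// mulNr opprK.
Qed.

(** The pointwise infimum works. It is finite since every [q x] is at least [- p (- x)], and it is
    subadditive since the smaller of two members bounds the value at [x + y] by the sum of their
    values. *)
Lemma sublinear_chain_inf p (F : set (V -> R)) : F !=set0 ->
  (forall q, F q -> sublinear q /\ forall x, q x <= p x) ->
  (forall q q', F q -> F q' ->
     (forall x, q x <= q' x) \/ (forall x, q' x <= q x)) ->
  exists2 q, sublinear q & forall q', F q' -> forall x, q x <= q' x.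
Proof.
move=> [q0 Fq0] Fs tot; pose E x := [set q x | q in F].
have lbE x q : F q -> inf (E x) <= q x.
  move=> Fq; apply: ge_inf; last by exists q.
  exists (- p (- x)) => _ [q' Fq' <-].
  have [sq' q'p] := Fs _ Fq'; have := sublinear_geN x sq'.
  by have := q'p (- x); lra.
have geE x r : (forall q, F q -> r <= q x) -> r <= inf (E x).
  move=> rq; apply: lb_le_inf; first by exists (q0 x), q0.
  by move=> _ [q Fq <-]; exact: rq.
have Es t x : 0 < t -> t * inf (E x) <= inf (E (t *: x)).
  move=> t0; apply: geE => q Fq; have [[_ qZ] _] := Fs _ Fq; rewrite (qZ _ _ (ltW t0)).
  by rewrite ler_pM2l// lbE.
exists (fun x => inf (E x)); last by move=> q Fq x; exact: lbE.
split=> [x y|t x] /=.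
  rewrite -lerBlDl; apply: (geE y) => v Fv; rewrite lerBlDl -lerBlDr.
  apply: (geE x) => u Fu; rewrite lerBlDr.
  have [uv|vu] := tot _ _ Fu Fv.
    rewrite (le_trans (lbE _ _ Fu))//; have [[su _] _] := Fs _ Fu.
    by rewrite (le_trans (su _ _))// lerD2l.
  rewrite (le_trans (lbE _ _ Fv))//; have [[sv _] _] := Fs _ Fv.
  by rewrite (le_trans (sv _ _))// lerD2r.
rewrite le_eqVlt => /predU1P[<-|t0].
  rewrite scale0r mul0r; apply/eqP; rewrite eq_le; apply/andP; split.
    by rewrite (le_trans (lbE _ _ Fq0))// sublinear0//; have [] := Fs _ Fq0.
  by apply: geE => q Fq; rewrite sublinear0//; have [] := Fs _ Fq.
apply/eqP; rewrite eq_le Es// andbT.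
rewrite -ler_pdivrMl// (le_trans (Es _ _ _)) ?invr_gt0//.
by rewrite scalerA mulVf ?gt_eqF// scale1r.
Qed.

Lemma sublinear_dominates p : sublinear p -> exists q : V -> R,
  (forall a x y, q (a *: x + y) = a * q x + q y) /\ forall x, q x <= p x.
Proof.
move=> sp; pose T := {q : V -> R | sublinear q /\ forall x, q x <= p x}.
(* The order is reversed, so that a maximal element is a minimal sublinear functional. *)
pose rel (q q' : T) := `[< forall x, sval q' x <= sval q x >].
have [|r s t /asboolP rs /asboolP st||F totF|q qmax] := @Zorn T rel.
- by move=> q; apply/asboolP.
- by apply/asboolP => x; exact: le_trans (st x) (rs x).
- move=> [q1 h1] [q2 h2] /asboolP/= h21 /asboolP/= h12; apply: eq_exist.
  by apply/funext => x; apply: le_anti; rewrite h21 h12.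
- have [[q0 Fq0]|F0] := pselect (F !=set0); last first.
    exists (exist _ p (conj sp (fun x => lexx _))) => s Fs.
    by exfalso; apply: F0; exists s.
  have [|q [q1 h] <-|q q' [[q1 h] Fq <-] [[q2 h'] Fq' <-]|q sq qF] :=
    @sublinear_chain_inf p [set sval q | q in F].
  + by exists (sval q0), q0.
  + exact: (svalP q1).
  + by have [/asboolP|/asboolP] := totF _ _ Fq Fq'; [right|left].
  + have qp x : q x <= p x.
      apply: le_trans ((svalP q0).2 x); apply: qF; by exists q0.
    exists (exist _ q (conj sq qp)) => s Fs; apply/asboolP => x /=.
    by apply: qF; exists s.
exists (sval q); split; last exact: (svalP q).2.
apply: minimal_sublinear_linear; first exact: (svalP q).1.
move=> q' sq' q'q.
have q'p x : q' x <= p x by rewrite (le_trans (q'q x))// (svalP q).2.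
have := qmax (exist _ q' (conj sq' q'p)).
by move=> <-//; apply/asboolP.
Qed.

(* Mazur-Orlicz form of the Hahn-Banach theorem *)
Lemma Hahn_Banach_cone p (A : set (V * R)) : sublinear p -> cone A ->
  (forall u, A u -> u.2 <= p u.1) -> exists g : V -> R,
  [/\ (forall a x y, g (a *: x + y) = a * g x + g y),
      (forall x, g x <= p x) & forall u, A u -> u.2 <= g u.1].
Proof.
move=> sp cA Ap; have [g [gl gq]] :=
  sublinear_dominates (cone_inf_sublinear sp cA Ap).
exists g; split=> // [x|u Au].
  exact: le_trans (gq x) (cone_inf_leP sp cA Ap x).
have g0 : g 0 = 0 by have := gl (-1) 0 0; rewrite scaler0 addr0; lra.
have := gl (-1) u.1 0; rewrite scaleN1r addr0 g0.
by have := le_trans (gq (- u.1)) (cone_inf_bound sp Ap Au); lra.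
Qed.

End Hahn_Banach.

(** * Functionals and ultrafilter limits *)

Section functionals.
Context (R : realType) (X : normedModType R).
Implicit Types (f g T : 'L(X, R)) (x y : X).

Lemma functionalDE f g x : (f + g) x = f x + g x. Proof. by []. Qed.
Lemma functionalNE f x : (- f) x = - f x. Proof. by []. Qed.
Lemma functionalZE (a : R) f x : (a *: f) x = a * f x. Proof. by []. Qed.

Lemma functional_comb f (a b : R) x y :
  f (a *: x + b *: y) = a * f x + b * f y.
Proof. by rewrite linearD !linearZ. Qed.

Lemma functional_le f x : `|x| <= 1 -> `|f x| <= `|f|.
Proof.
move=> x1; rewrite (le_trans (operator_norm_le f x))//.
by rewrite ler_piMr// normr_ge0.
Qed.

Lemma functional_norm_le f (M : R) :
  (forall x, `|x| <= 1 -> `|f x| <= M) -> `|f| <= M.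
Proof. by move=> fM; apply: sup_norm_le; first by exists 0; rewrite /= normr0 ler01. Qed.

Lemma functional_norm_le1 f (M : R) :
  (forall x, `|x| <= 1 -> f x <= M) -> `|f| <= M.
Proof.
move=> fM; apply: functional_norm_le => x x1; rewrite ler_norml fM// andbT.
by rewrite lerNl -linearN fM// normrN.
Qed.

Lemma functional_norm_adherent f (e : R) : 0 < e ->
  exists2 x, `|x| <= 1 & `|f| - e < f x.
Proof.
move=> e0; apply: contrapT => fe.
suff : `|f| <= `|f| - e by lra.
apply: functional_norm_le1 => x x1; rewrite leNgt; apply/negP => fx.
by apply: fe; exists x.
Qed.

Lemma functional_of_bounded (f : X -> R) (M : R) :
  (forall a x y, f (a *: x + y) = a * f x + f y) ->
  (forall x, `|f x| <= M * `|x|) -> exists F : 'L(X, R), F = f :> (X -> R).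
Proof.
move=> lf fM; have fB : f \in @is_bounded_operator R X R.
  by apply/is_bounded_operatorP; split=> //; exists M.
by exists (BoundedOperator fB).
Qed.

Lemma functional_ext f g : f =1 g -> f = g.
Proof. by move=> fg; apply/val_inj/funext. Qed.

(** Hahn-Banach with the norm as dominating functional; the ray through [(x0, |x0|)] is the cone of
    constraints. *)
Lemma norming_functional x0 : exists2 f : 'L(X, R), `|f| <= 1 & f x0 = `|x0|.
Proof.
have sp : sublinear (fun x : X => `|x|).
  split; first exact: ler_normD.
  by move=> t x t0; rewrite normrZ ger0_norm.
pose A : set (X * R) := [set u | exists2 t : R, 0 <= t & u = (t *: x0, t * `|x0|)].
have cA : cone A.
  split.
  - by exists 0 => //; rewrite scale0r mul0r.
  - move=> _ _ [s s0 ->] [t t0 ->]; exists (s + t); first exact: addr_ge0.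
    by rewrite scalerDl mulrDl.
  - move=> t _ t0 [s s0 ->]; exists (t * s); first exact: mulr_ge0.
    by rewrite /= scalerA mulrA.
have Ap u : A u -> u.2 <= `|u.1|.
  by move=> [t t0 ->] /=; rewrite normrZ ger0_norm.
have [g [gl gp Ag]] := Hahn_Banach_cone sp cA Ap.
have g0 : g 0 = 0 by have := gl (-1) 0 0; rewrite scaler0 addr0; lra.
have gN x : g (- x) = - g x.
  by have := gl (-1) x 0; rewrite scaleN1r addr0 g0; lra.
have gb x : `|g x| <= 1 * `|x|.
  by rewrite mul1r ler_norml gp andbT lerNl -gN (le_trans (gp _))// normrN.
have [f fg] := functional_of_bounded gl gb; exists f.
  by apply: functional_norm_le => x x1; rewrite fg (le_trans (gb x))// mul1r.
rewrite fg; apply/eqP; rewrite eq_le gp/=.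
by have := Ag (1 *: x0, 1 * `|x0|); rewrite scale1r mul1r; apply; exists 1;
  rewrite ?ler01// scale1r mul1r.
Qed.

End functionals.

Section ultrafilter_limits.

(** Compactness of [[-M, M]] gives a cluster point, and an ultrafilter converges to each of its
    cluster points. *)
Lemma ultra_cvg (R : realType) (I : Type) (U : set_system I) (u : I -> R) (M : R) :
  UltraFilter U -> (forall i, `|u i| <= M) -> exists l : R, u i @[i --> U] --> l.
Proof.
move=> UU uM; have FF : ProperFilter (u i @[i --> U]) by exact: fmap_proper_filter.
have [|l [_ ul]] := @segment_compact R (- M) M _ FF.
  apply: (@filterS _ U _ setT); last exact: filterT.
  by move=> i _; rewrite /= in_itv/= -ler_norml.
exists l => B lB; have [//|UC] := in_ultra_setVsetC (u @^-1` B) UU.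
have [x [+ Bx]] : ~` B `&` B !=set0 by exact: ul.
by move=> /(_ Bx).
Qed.

Context (R : realType) (X : normedModType R).

(** A form of the Banach-Alaoglu theorem: pointwise limits along [U] inherit linearity and the bound
    [M]. *)
Lemma ultra_functional (I : Type) (U : set_system I) (f : I -> 'L(X, R)) (M : R) :
  UltraFilter U -> (forall i, `|f i| <= M) ->
  exists w : 'L(X, R), forall x, f i x @[i --> U] --> w x.
Proof.
move=> UU fM.
have fx x : exists l : R, f i x @[i --> U] --> l.
  apply: (@ultra_cvg _ _ _ _ (M * `|x|)) => // i.
  by rewrite (le_trans (operator_norm_le _ _))// ler_wpM2r.
pose w x : R := sval (cid (fx x)).
have wP x : f i x @[i --> U] --> w x by exact: (svalP (cid (fx x))).
have wl a x y : w (a *: x + y) = a * w x + w y.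
  apply: (@cvg_unique R (@norm_hausdorff R R) _ _ _ _ (wP _)).
  rewrite (_ : (fun i => _) = (fun i => a * f i x + f i y)).
    by apply: cvgD => //; apply: cvgMl_tmp.
  by apply/funext => i; rewrite linearP.
have wb x : `|w x| <= M * `|x|.
  have wx : `|f i x| @[i --> U] --> `|w x| by apply: cvg_norm.
  apply: (cvgr_to_le wx); apply: nearW => i.
  by rewrite (le_trans (operator_norm_le _ _))// ler_wpM2r.
have [F Fw] := functional_of_bounded wl wb.
by exists F => x; rewrite Fw; exact: wP.
Qed.

End ultrafilter_limits.

(** * James' theorem *)

(** The sets [D n] form a filter base, and the condition [n <= m] makes its filter contain all
    cofinite sets. *)
Lemma nested_ultrafilter (D : nat -> set nat) :
  (forall n, D n !=set0) -> (forall n, D n.+1 `<=` D n) ->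
  (forall n m, D n m -> (n <= m)%N) ->
  exists U : set_system nat, [/\ UltraFilter U, forall n, U (D n) & \oo `<=` U].
Proof.
move=> D0 Ddecr Dge.
have DD n m : (n <= m)%N -> D m `<=` D n.
  move=> /subnKC <-; elim: (m - n)%N => [|k IH]; rewrite ?addn0//.
  by rewrite addnS => i /Ddecr/IH.
have DF : ProperFilter (filter_from [set: nat] D).
  apply: filter_from_proper => //; apply: filter_from_filter; first by exists 0%N.
  move=> m n _ _; exists (maxn m n) => // i Di.
  by split; apply: DD Di; rewrite ?leq_maxl ?leq_maxr.
have [U [UU DU]] := ultraFilterLemma DF.
exists U; split=> // [n|B [N _ NB]]; apply: DU.
  by exists n.
by exists N => // m /Dge; exact: NB.
Qed.

Lemma free_ultrafilter (A : set nat) :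
  (forall N, exists2 n, (N <= n)%N & A n) ->
  exists U : set_system nat, [/\ UltraFilter U, U A & \oo `<=` U].
Proof.
move=> Ainf.
have [N|n m [nm Am]|n m []//|U [UU UA Uoo]] :=
    @nested_ultrafilter (fun N => [set n | (N <= n)%N /\ A n]).
- by have [n Nn An] := Ainf N; exists n.
- by split=> //; exact: ltnW.
- by exists U; split=> //; apply: filterS (UA 0%N) => n [].
Qed.

(* The dyadic sums [y n] are built from near-minimizers [g n] in [C n] of
   [`|y n + 2^-n g|], so [`|y n|] stays below the norm of their limit [z] by a
   fixed multiple of [2^-n]. At a point [x] the tail of the series for [z x] is
   [o(2^-n)], which leaves [z x] short of [`|z|]. *)
Section James.
Context (R : realType) (X : normedModType R).
Context (C : nat -> set 'L(X, R)) (M theta : R).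
Hypothesis theta0 : 0 < theta.
Hypothesis C0 : forall n, C n !=set0.
Hypothesis Cdecr : forall n, C n.+1 `<=` C n.
Hypothesis Cmid : forall n f g, C n f -> C n g -> C n (2^-1 *: (f + g)).
Hypothesis Cbound : forall g, C 0 g -> theta <= `|g| <= M.
Hypothesis Ccvg : forall x e, 0 < e -> exists n, forall g, C n g -> `|g x| <= e.

Let q n : R := 2^-1 ^+ n.
Let q0 n : 0 < q n. Proof. by apply: exprn_gt0; rewrite invr_gt0. Qed.
Let qS n : q n.+1 = q n / 2. Proof. by rewrite /q exprSr. Qed.

Let Cn0 n : C n `<=` C 0.
Proof. by elim: n => // n IH; move=> g /Cdecr/IH. Qed.

Let CnM n g : C n g -> `|g| <= M.
Proof. by move=> /Cn0/Cbound/andP[]. Qed.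

Let a n (y : 'L(X, R)) := inf [set `|y + q n *: g| | g in C n].

Let a_le n y g : C n g -> a n y <= `|y + q n *: g|.
Proof.
move=> Cg; rewrite /a; apply: ge_inf; last by exists g.
by exists 0 => _ [h _ <-].
Qed.

Let le_a n y r : (forall g, C n g -> r <= `|y + q n *: g|) -> r <= a n y.
Proof.
move=> rg; apply: lb_le_inf; last by move=> _ [g Cg <-]; exact: rg.
by have [g Cg] := C0 n; exists `|y + q n *: g|, g.
Qed.

Let nearmin n y : exists g, C n g /\ `|y + q n *: g| <= a n y + theta / 4 * q n ^+ 2.
Proof.
have e0 : 0 < theta / 4 * q n ^+ 2 by rewrite mulr_gt0 ?divr_gt0 ?exprn_gt0.
apply: contrapT => H.
suff : a n y + theta / 4 * q n ^+ 2 <= a n y by lra.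
apply: le_a => g Cg; rewrite leNgt; apply/negP => gl; apply: H.
by exists g; split=> //; exact: ltW.
Qed.

Let G n y : 'L(X, R) := sval (cid (nearmin n y)).
Let CG n y : C n (G n y). Proof. by have [] := svalP (cid (nearmin n y)). Qed.
Let Gmin n y : `|y + q n *: G n y| <= a n y + theta / 4 * q n ^+ 2.
Proof. by have [] := svalP (cid (nearmin n y)). Qed.

(** The near-minimizer enters with half the weight [q m] used in the minimization, so each sum is
    the midpoint of the previous one and of a nearly minimal point. *)
Fixpoint James_sums n : 'L(X, R) :=
  if n is m.+1 then James_sums m + q m.+1 *: G m (James_sums m) else 0.
Let y := James_sums.

Let yS n : y n.+1 = y n + q n.+1 *: G n (y n). Proof. by []. Qed.

(** Adding [g] to [y n.+1] with weight [q n.+1] amounts to adding to [y n], with weight [q n], the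
    midpoint of [g] and the chosen near-minimizer. *)
Let a_incr n : a n (y n) <= a n.+1 (y n.+1).
Proof.
apply: le_a => g Cg.
have -> : y n.+1 + q n.+1 *: g = y n + q n *: (2^-1 *: (G n (y n) + g)).
  by rewrite yS -addrA -scalerDr qS scalerA.
by apply: a_le; apply: Cmid => //; exact: Cdecr.
Qed.

Let a_mono m n : (m <= n)%N -> a m (y m) <= a n (y n).
Proof. exact: (@nondecreasing_seqP _ _ (fun n => a n (y n))).1. Qed.

Let y_step n : `|y n.+1| <= (`|y n| + (a n (y n) + theta / 4 * q n ^+ 2)) / 2.
Proof.
have -> : y n.+1 = 2^-1 *: (y n + (y n + q n *: G n (y n))).
  rewrite yS qS addrA !scalerDr scalerA -scalerDl mulrC.
  by rewrite (_ : 2^-1 + 2^-1 = 1) ?scale1r//; lra.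
rewrite normrZ ger0_norm ?invr_ge0// mulrC ler_pM2r ?invr_gt0//.
by rewrite (le_trans (ler_normD _ _))// lerD2l.
Qed.

(** Each step halves the gap, up to an error [theta / 8 * q n ^+ 2] from near-minimization; the
    quadratic term is exactly the slack that absorbs these errors. *)
Let gap n : theta / 2 * (q n + q n ^+ 2) <= a n (y n) - `|y n|.
Proof.
elim: n => [|n IH].
  rewrite normr0 subr0; apply: le_a => g Cg.
  rewrite /q expr0 add0r scale1r expr1n; have /andP[+ _] := Cbound Cg; lra.
have := y_step n; have := a_incr n; move: IH; rewrite qS.
move: (a n.+1 _) (a n _) (q n) `|y n.+1| `|y n| => B A Q Y' Y; lra.
Qed.

Let y_bound n : `|y n| <= M * (1 - q n).
Proof.
elim: n => [|n IH]; first by rewrite normr0 /q expr0 subrr mulr0.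
rewrite yS (le_trans (ler_normD _ _))// normrZ gtr0_norm//.
have := ler_wpM2l (ltW (q0 n)) (CnM (CG n (y n))); move: IH; rewrite qS.
move: (q n) `|y n| `|G _ _| => Q Y g; lra.
Qed.

Let y_cauchy n m x e : (forall g, C n g -> `|g x| <= e) ->
  `|y (n + m) x - y n x| <= (q n - q (n + m)) * e.
Proof.
move=> ge; elim: m => [|m IH]; first by rewrite addn0 !subrr normr0 mul0r.
rewrite addnS yS.
rewrite (_ : _ - _ = (y (n + m) x - y n x) + q (n + m).+1 * G (n + m) (y (n + m)) x); last first.
  by rewrite functionalDE functionalZE addrAC.
rewrite (le_trans (ler_normD _ _))// normrM (gtr0_norm (q0 _)).
have : `|G (n + m) (y (n + m)) x| <= e.
  apply: ge; have : C (n + m) `<=` C n.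
    by elim: m {IH} => [|m IH]; rewrite ?addn0// addnS => g /Cdecr/IH.
  by apply; exact: CG.
move=> /(ler_wpM2l (ltW (q0 (n + m)))); move: IH; rewrite qS.
move: (q n) (q (n + m)) `|y (n + m) x - y n x| `|_ x| => Q Q' Y g; lra.
Qed.

Lemma James_not_NA : exists z : 'L(X, R), ~ NA X R z.
Proof.
have [|U [UU _ Uoo]] := @free_ultrafilter setT; first by move=> N; exists N.
have M0 : 0 <= M by have [g Cg] := C0 0; exact: le_trans (CnM Cg).
have yM n : `|y n| <= M.
  by rewrite (le_trans (y_bound n))// ler_piMr// lerBlDr lerDl ltW.
have [z yz] := ultra_functional UU yM.
have z_y n x e : (forall g, C n g -> `|g x| <= e) -> `|z x - y n x| <= q n * e.
  move=> ge; have [g Cg] := C0 n; have e0 : 0 <= e by exact: le_trans (ge _ Cg).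
  have zy : `|y i x - y n x| @[i --> U] --> `|z x - y n x|.
    by apply: cvg_norm; apply: cvgB => //; exact: cvg_cst.
  apply: (cvgr_to_le zy); apply: Uoo; exists n => // i /= ni.
  rewrite -(subnKC ni) (le_trans (y_cauchy _ ge))// ler_wpM2r// lerBlDr lerDl.
  exact: ltW.
have y_z n : `|y n| <= `|z| + q n * M.
  apply: functional_norm_le => x x1.
  have : `|z x - y n x| <= q n * M.
    apply: z_y => g Cg; rewrite (le_trans (functional_le _ x1))//; exact: CnM Cg.
  by have := functional_le z x1; rewrite !ler_norml; lra.
(* For large [k], [a n (y n)] is at most [a k (y k)], hence at most [|y k| + q k * M], hence at most
   [|z| + 2 * q k * M]. *)
have a_z n : a n (y n) <= `|z|.
  apply/ler_addgt0Pr => e e0.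
  have [m me] : exists m, q m * (M * 2 + 1) <= e.
    have /cvgrPdist_le/(_ (e / (M * 2 + 1))) : q k @[k --> \oo] --> (0 : R).
      by apply: cvg_expr; rewrite gtr0_norm ?invr_gt0// invf_lt1//; lra.
    have M1 : 0 < M * 2 + 1 by lra.
    rewrite divr_gt0// => /(_ isT)[m _ /(_ m (leqnn m))]; rewrite sub0r normrN gtr0_norm//.
    by rewrite ler_pdivlMr//; exists m.
  pose k := maxn n m; have [g Cg] := C0 k.
  have qk : q k <= q m.
    by apply: ler_wiXn2l; rewrite ?invr_ge0 ?invf_le1// ?leq_maxr//; lra.
  have yg : `|y k + q k *: g| <= `|y k| + q k * `|g|.
    by rewrite (le_trans (ler_normD _ _))// normrZ gtr0_norm.
  have := le_trans (a_le (y k) Cg) yg; have := a_mono (leq_maxl n m); rewrite -/k.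
  have := y_z k; have := ler_wpM2l (ltW (q0 k)) (CnM Cg).
  have M1 : 0 <= M * 2 + 1 by lra.
  have := le_trans (ler_wpM2r M1 qk) me; have := q0 k.
  move: (a n (y n)) (a k (y k)) `|y k| `|z| `|g| (q k) => *; lra.
exists z => -[x [x1 zx]].
(* The tail of the series at [x] is then at most [theta / 4 * q n], less than the gap, which is at
   least [theta / 2 * q n]. *)
have [|n Cx] := @Ccvg x (theta / 4); first by rewrite divr_gt0.
have := z_y _ _ _ Cx; have := gap n; have := a_z n.
have x1' : `|x| <= 1 by rewrite x1.
have := functional_le (y n) x1'; have := q0 n.
have := sqr_ge0 (q n).
have : `|z x| <= `|y n x| + `|z x - y n x| by rewrite -lerBlDl lerB_dist.
rewrite zx; have := theta0; nra.
Qed.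

End James.

(** * Pointwise convergent subsequences when the dual is strictly convex *)

Section weak_star_limits.
Context (R : realType) (X : normedModType R) (f : nat -> 'L(X, R)).
Hypothesis f1 : forall n, `|f n| <= 1.

Definition frequent (A : set nat) := forall N, exists2 n, (N <= n)%N & A n.

(** The weak-star cluster points of the subsequence indexed by [A]. *)
Definition ultra_limits (A : set nat) : set 'L(X, R) :=
  [set w | exists U, [/\ UltraFilter U, U A, \oo `<=` U &
    forall x, f n x @[n --> U] --> w x]].

Lemma ultra_limits_nonempty A : frequent A -> ultra_limits A !=set0.
Proof.
move=> /free_ultrafilter[U [UU UA Uoo]].
by have [w fw] := ultra_functional UU f1; exists w, U.
Qed.

Lemma ultra_limits_le A w x r : ultra_limits A w ->
  (forall n, A n -> r <= f n x) -> r <= w x.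
Proof.
move=> [U [UU UA _ /(_ x) fw]] Ar; apply: (cvgr_to_ge fw).
by apply: filterS UA.
Qed.

Lemma ultra_limits_norm A w : ultra_limits A w -> `|w| <= 1.
Proof.
move=> [U [UU UA _ fw]]; apply: functional_norm_le => x x1.
have wx : `|f n x| @[n --> U] --> `|w x| by apply: cvg_norm; exact: fw.
apply: (cvgr_to_le wx); apply: (@filterS _ U _ setT); last exact: filterT.
by move=> n _; rewrite (le_trans (functional_le _ x1)).
Qed.

Lemma ultra_limits_sub A B w : A `<=` B -> ultra_limits A w -> ultra_limits B w.
Proof. by move=> AB [U [UU UA Uoo fw]]; exists U; split=> //; exact: filterS UA. Qed.

(* The functionals of [ultra_limits A'] all exceed [sup - e] at a common point,
   where the supremum is that of the norms over [ultra_limits A]. *)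
Lemma ultra_limits_shrink A e : frequent A -> 0 < e ->
  exists A', [/\ frequent A', A' `<=` A & forall w w1 w2,
    ultra_limits A' w -> ultra_limits A' w1 -> ultra_limits A' w2 ->
    `|w| <= `|2^-1 *: (w1 + w2)| + e].
Proof.
move=> Af e0; pose N := sup [set `|w| | w in ultra_limits A].
have ubN w : ultra_limits A w -> `|w| <= N.
  move=> Aw; apply: ub_le_sup; last by exists w.
  by exists 1 => _ [w' /ultra_limits_norm ? <-].
have e20 : 0 < e / 2 by rewrite divr_gt0.
have hs : has_sup [set `|w| | w in ultra_limits A].
  split; last by exists 1 => _ [w' /ultra_limits_norm ? <-].
  by have [w Aw] := ultra_limits_nonempty Af; exists `|w|, w.
have [_ [w Aw <-] Nw] := sup_adherent e20 hs.
rewrite -/N in Nw.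
have [x x1 wx] := functional_norm_adherent w e20.
have Nwx : N - e < w x by lra.
exists (A `&` [set n | N - e <= f n x]); split.
- case: Aw => U [UU UA Uoo /(_ x) /cvgr_ge /(_ _ Nwx) fx] k.
  have /filter_ex[n [[An fn] kn]] :
      U (A `&` [set n | N - e <= f n x] `&` [set n | (k <= n)%N]).
    by apply: filterI; [exact: filterI|apply: Uoo; exists k].
  by exists n.
- by move=> n [].
- move=> w' w1 w2 Aw' Aw1 Aw2.
  have w'N : `|w'| <= N by apply: ubN; apply: ultra_limits_sub Aw' => n [].
  have w1x : N - e <= w1 x by apply: (ultra_limits_le Aw1) => n [].
  have w2x : N - e <= w2 x by apply: (ultra_limits_le Aw2) => n [].
  have := functional_le (2^-1 *: (w1 + w2)) x1.
  rewrite functionalZE functionalDE ler_norml; lra.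
Qed.

(** Strict convexity carried from the unit sphere to the sphere of radius [|u|]; for radius 0 both
    vectors vanish. *)
Lemma strictly_convex_eq (V : normedModType R) (u v : V) : strictly_convex V ->
  `|u| = `|v| -> `|u| <= `|2^-1 *: (u + v)| -> u = v.
Proof.
move=> sV uv le_uv; apply/eqP/negPn/negP => neq.
have u0 : 0 < `|u|.
  rewrite lt_neqAle normr_ge0 andbT eq_sym; apply: contra neq => u0.
  by move: (u0); rewrite uv; move: u0; rewrite !normr_eq0 => /eqP-> /eqP->.
have nu : `| `|u|^-1 *: u| = 1 by rewrite normfZV// -normr_gt0.
have nv : `| `|u|^-1 *: v| = 1 by rewrite uv normfZV// -normr_gt0 -uv.
have := sV _ _ nu nv; rewrite -scalerDr scalerA mulrC -scalerA normrZ.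
rewrite gtr0_norm ?invr_gt0// mulrC ltr_pdivrMr// mul1r ltNge le_uv => H.
suff : false by []; apply: H; apply: contra neq => /eqP/scalerI.
by rewrite invr_eq0 gt_eqF// => /(_ isT) ->.
Qed.

(* All ultrafilter limits along the nested sets have the same norm, and so do
   their midpoints: by strict convexity there is only one limit. *)
Lemma nested_limit : strictly_convex 'L(X, R) ->
  exists (B : nat -> set nat) (h : 'L(X, R)),
  [/\ forall n, B n !=set0, forall n, B n.+1 `<=` B n,
    forall n m, B n m -> (n <= m)%N &
    forall x e, 0 < e -> exists n, forall m, B n m -> `|f m x - h x| <= e].
Proof.
move=> sc.
have shrink (n : nat) (A : {A | frequent A}) : {A' : {A | frequent A} |
    sval A' `<=` sval A /\ forall w w1 w2, ultra_limits (sval A') w ->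
    ultra_limits (sval A') w1 -> ultra_limits (sval A') w2 ->
    `|w| <= `|2^-1 *: (w1 + w2)| + n.+1%:R^-1}.
  apply: cid; have n0 : 0 < n.+1%:R^-1 :> R by rewrite invr_gt0.
  have [A' [fA' AA' H]] := ultra_limits_shrink (svalP A) n0.
  by exists (exist _ A' fA').
have fT : frequent setT by move=> n; exists n.
pose A := fix A n := if n is m.+1 then sval (shrink m (A m)) else exist _ _ fT.
(* The condition [n <= m] makes every ultrafilter containing all the [B n] free. *)
pose B n := [set m | (n <= m)%N /\ sval (A n) m].
have BS n : B n.+1 `<=` B n.
  by move=> m [/ltnW nm Am]; split=> //; have [AS _] := svalP (shrink n (A n)); exact: AS.
have B0 n : B n !=set0 by have [m nm Am] := svalP (A n) n; exists m.
have lim_eq h w : (forall n, ultra_limits (B n) h) -> (forall n, ultra_limits (B n) w) -> h = w.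
  move=> Bh Bw.
  have key u v1 v2 : (forall n, ultra_limits (B n) u) -> (forall n, ultra_limits (B n) v1) ->
      (forall n, ultra_limits (B n) v2) -> `|u| <= `|2^-1 *: (v1 + v2)|.
    move=> Bu Bv1 Bv2; apply/ler_addgt0Pr => e e0.
    have [n ne] : exists n, n.+1%:R^-1 <= e.
      have [n _ /(_ n (leqnn n))/ltW] := near_infty_natSinv_lt (PosNum e0).
      by exists n.
    have subA v : (forall n, ultra_limits (B n) v) -> ultra_limits (sval (A n.+1)) v.
      by move=> /(_ n.+1); apply: ultra_limits_sub => m [].
    have [_ H] := svalP (shrink n (A n)).
    by rewrite (le_trans (H _ _ _ (subA _ Bu) (subA _ Bv1) (subA _ Bv2)))// lerD2l.
  have half (v : 'L(X, R)) : 2^-1 *: (v + v) = v.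
    by rewrite scalerDr -scalerDl (_ : 2^-1 + 2^-1 = 1) ?scale1r//; lra.
  apply: strictly_convex_eq => //; last exact: key.
  by apply/le_anti/andP; split; [rewrite -(half w)|rewrite -(half h)]; exact: key.
have [|U [UU UB Uoo]] := nested_ultrafilter B0 BS; first by move=> n m [].
have [h fh] := ultra_functional UU f1.
exists B, h; split=> // [n m []//|x e e0]; apply: contrapT => nconv.
(* If convergence at [x] fails, an ultrafilter on the exceptional indices gives a second limit, at
   distance at least [e] from [h] at [x]. *)
have D0 n : (B n `&` [set m | e < `|f m x - h x|]) !=set0.
  apply: contrapT => H; apply: nconv; exists n => m Bm.
  by rewrite leNgt; apply/negP => em; apply: H; exists m.
have [n m [/BS]//|n m [[]]//|U' [UU' UB' Uoo']] := nested_ultrafilter D0.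
have [w fw] := ultra_functional UU' f1.
have whx : `|f n x - h x| @[n --> U'] --> `|w x - h x|.
  by apply: cvg_norm; apply: cvgB; [exact: fw|exact: cvg_cst].
have : e <= `|w x - h x|.
  apply: (cvgr_to_ge whx); apply: filterS (UB' 0%N) => n [_] /=; exact: ltW.
suff -> : w = h by rewrite subrr normr0 leNgt e0.
apply: lim_eq => n.
  by exists U'; split=> //; apply: filterS (UB' n) => m [].
by exists U; split.
Qed.

End weak_star_limits.

(** Using midpoints only, instead of all convex combinations, the hull of a sequence is exhausted by
    finite stages. *)
Inductive mid_hull (R : realType) (V : normedModType R) (A : set V) : set V :=
| mid_hull_base v : A v -> mid_hull A v
| mid_hull_mid u v : mid_hull A u -> mid_hull A v ->
    mid_hull A (2^-1 *: (u + v)).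

Lemma mid_hull_sub (R : realType) (V : normedModType R) (A B : set V) :
  A `<=` B -> mid_hull A `<=` mid_hull B.
Proof.
move=> AB v; elim=> [u /AB Bu|u w _ IHu _ IHw]; first exact: mid_hull_base.
exact: mid_hull_mid.
Qed.

Lemma mid_hull_norm (R : realType) (V : normedModType R) (A : set V) (M : R) :
  (forall v, A v -> `|v| <= M) -> forall v, mid_hull A v -> `|v| <= M.
Proof.
move=> AM v; elim=> [u /AM//|u w _ uM _ wM].
rewrite normrZ gtr0_norm ?invr_gt0//; have := ler_normD u w; lra.
Qed.

(** * Separation in the bidual, and functionals not attaining their norm *)

Section bidual.
Context (R : realType) (X : completeNormedModType R).
Notation can := (@canonical_embedding R X).

Lemma canonical_embedding_linear (a : R) (x y : X) :
  can (a *: x + y) = a *: can x + can y.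
Proof. by apply: functional_ext => f /=; rewrite linearP. Qed.

Lemma canonical_embeddingB (x y : X) : can (x - y) = can x - can y.
Proof. by apply: functional_ext => f /=; rewrite linearB. Qed.

Lemma norm_canonical_embedding (x : X) : `|can x| = `|x|.
Proof.
apply/le_anti/andP; split.
  apply: functional_norm_le => f f1 /=.
  by rewrite (le_trans (operator_norm_le f x))// ler_piMl.
have [f f1 fx] := norming_functional x.
by have := functional_le (can x) f1; rewrite /= fx normr_id.
Qed.

(** The embedding is isometric, so approximating points form a Cauchy sequence in the complete space
    [X]. *)
Lemma canonical_embedding_closed (F : 'L('L(X, R), R)) :
  (forall d, 0 < d -> exists x, `|F - can x| < d) -> exists x, F = can x.
Proof.
move=> approx.
have xn n : exists x, `|F - can x| < n.+1%:R^-1 by apply: approx; rewrite invr_gt0.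
pose x n : X := sval (cid (xn n)).
have xP n : `|F - can (x n)| < n.+1%:R^-1 by exact: (svalP (cid (xn n))).
have xdist m n : `|x m - x n| < m.+1%:R^-1 + n.+1%:R^-1.
  rewrite -norm_canonical_embedding canonical_embeddingB.
  rewrite (_ : _ - _ = (F - can (x n)) - (F - can (x m))); last first.
    by rewrite opprB [RHS]addrC addrA subrK.
  by rewrite (le_lt_trans (ler_normB _ _))// addrC ltrD.
have /cauchy_cvgP/cvg_ex[l xl] : cauchy (x n @[n --> \oo]).
  apply: cauchy_exP => e e0; have e20 : 0 < e / 2 by rewrite divr_gt0.
  have [N _ Ne] := near_infty_natSinv_lt (PosNum e20).
  exists (x N); exists N => // m /Ne /= me; rewrite -ball_normE /=.
  by rewrite (lt_trans (xdist _ _))// (splitr e) ltrD//; exact: (Ne N (leqnn N)).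
exists l; apply/eqP; rewrite -subr_eq0 -normr_le0; apply/ler_addgt0Pr => e e0.
rewrite add0r.
have e20 : 0 < e / 2 by rewrite divr_gt0.
have [n [ne le]] : exists n, n.+1%:R^-1 <= e / 2 /\ `|l - x n| <= e / 2.
  have H1 := near_infty_natSinv_lt (PosNum e20).
  have H2 : \forall n \near \oo, `|l - x n| <= e / 2 by move/cvgrPdist_le : xl; apply.
  have [n [/ltW ? ?]] := filter_ex (filterI H1 H2); by exists n.
rewrite (_ : _ - _ = (F - can (x n)) - (can l - can (x n))); last first.
  by rewrite opprB addrA subrK.
rewrite (le_trans (ler_normB _ _))// -canonical_embeddingB norm_canonical_embedding.
by rewrite (splitr e) lerD// (le_trans _ ne)// ltW.
Qed.

(** Induction on [E]. If some [f0] vanishes on the tail but not at the head [x], subtracting a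
    multiple of [can x] from [T] reduces to the tail; otherwise vanishing at [x] already follows
    from vanishing on the tail. *)
Lemma functional_of_finite_kernel (E : seq X) (T : 'L('L(X, R), R)) :
  (forall f : 'L(X, R), (forall x, x \in E -> f x = 0) -> T f = 0) -> exists x, T = can x.
Proof.
elim: E T => [|x E IH] T TE.
  by exists 0; apply: functional_ext => f /=; rewrite TE// linear0.
have [[f0 f0E f0x]|none] :=
  pselect (exists2 f0 : 'L(X, R), (forall y, y \in E -> f0 y = 0) & f0 x != 0).
  have [f fE|x' Tx'] := IH (T - (T f0 / f0 x) *: can x).
    pose g := f - (f x / f0 x) *: f0.
    have Tg : T g = 0.
      apply: TE => y; rewrite /g functionalDE functionalNE functionalZE inE.
      case/predU1P => [->|yE]; first by rewrite divfK// subrr.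
      by rewrite (fE y)// (f0E y)// mulr0 subrr.
    rewrite functionalDE functionalNE functionalZE /=.
    move: Tg; rewrite /g linearB linearZ/= => /eqP; rewrite subr_eq0 => /eqP ->.
    by rewrite /GRing.scale/=; field.
  exists ((T f0 / f0 x) *: x + x').
  by rewrite canonical_embedding_linear -Tx' addrC subrK.
apply: IH => f fE; apply: TE => y; rewrite inE => /predU1P[->|/fE//].
by apply: contrapT => /eqP fx; apply: none; exists f.
Qed.

(* Otherwise [F] has norm less than [d] on the annihilator of [E], and a
   Hahn-Banach extension of its restriction differs from [F] by an element of
   the canonical image of the span of [E]. *)
Lemma annihilator_far (F : 'L('L(X, R), R)) (d : R) (E : seq X) : 0 < d ->
  (forall x, d <= `|F - can x|) -> exists f : 'L(X, R),
  [/\ `|f| <= 1, (forall x, x \in E -> f x = 0) & d / 2 <= F f].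
Proof.
move=> d0 Fd; apply: contrapT => none.
have small (f : 'L(X, R)) : (forall x, x \in E -> f x = 0) -> F f <= d / 2 * `|f|.
  move=> fE; have [->|f0] := eqVneq f 0; first by rewrite linear0 normr0 mulr0.
  rewrite leNgt; apply/negP => Ff; apply: none; exists (`|f|^-1 *: f); split.
  - by rewrite normfZV.
  - by move=> x /fE fx; rewrite functionalZE fx mulr0.
  - rewrite linearZ/= [_ *: _]mulrC ler_pdivlMr ?normr_gt0//; exact: ltW.
have sp : sublinear (fun f : 'L(X, R) => d / 2 * `|f|).
  split=> [f g|t f t0]; first by rewrite -mulrDr ler_wpM2l ?ler_normD// ltW// divr_gt0.
  by rewrite normrZ ger0_norm// mulrCA.
pose A : set ('L(X, R) * R) :=
  [set u : 'L(X, R) * R | (forall x, x \in E -> u.1 x = 0) /\ u.2 = F u.1].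
have cA : cone A.
  split.
  - by split=> //=; rewrite linear0.
  - move=> u v [uE uF] [vE vF]; split=> [x xE|].
      by rewrite -[LHS]/(u.1 x + v.1 x) uE// vE// addr0.
    by rewrite -[LHS]/(u.2 + v.2) uF vF -linearD.
  - move=> t u t0 [uE uF]; split=> [x xE|] /=.
      by rewrite -[LHS]/(t * u.1 x) uE// mulr0.
    by rewrite linearZ uF.
have Ap u : A u -> u.2 <= d / 2 * `|u.1| by move=> [uE uF]; rewrite uF; exact: small.
have [g [gl gp Ag]] := Hahn_Banach_cone sp cA Ap.
have g0 : g 0 = 0 by have := gl (-1) 0 0; rewrite scaler0 addr0; lra.
have gN (f : 'L(X, R)) : g (- f) = - g f.
  by have := gl (-1) f 0; rewrite scaleN1r addr0 g0; lra.
have gb (f : 'L(X, R)) : `|g f| <= d / 2 * `|f|.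
  by rewrite ler_norml gp andbT lerNl -gN (le_trans (gp _))// normrN.
have [G Gg] := functional_of_bounded gl gb.
have [f fE|x Fx] := @functional_of_finite_kernel E (F - G).
  rewrite functionalDE functionalNE Gg; apply/eqP; rewrite subr_eq0.
  have := Ag (f, F f) (conj fE erefl).
  have Nf : A (- f, F (- f)) by split=> // x xE; rewrite -[LHS]/(- f x) fE// oppr0.
  have := Ag _ Nf; rewrite /= gN linearN => ? ?; apply/eqP/le_anti/andP; split; lra.
have := Fd x; rewrite -Fx opprB addrC subrK leNgt => /negP; apply.
rewrite (@le_lt_trans _ _ (d / 2))//; last lra.
apply: functional_norm_le => f f1; rewrite Gg (le_trans (gb f))//.
by rewrite ler_piMr// ltW// divr_gt0.
Qed.

(* The [n]-th functional vanishes on points norming the midpoint combinations of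
   the earlier ones, so the pointwise limit [h] vanishes on all these points and
   every midpoint combination stays at distance at least [rho] from [h]. *)
Lemma smooth_James : strictly_convex 'L(X, R) -> ~ reflexive_space X ->
  exists z : 'L(X, R), ~ NA X R z.
Proof.
move=> sc nrefl.
have [F Fx] : exists F : 'L('L(X, R), R), forall x, F <> can x.
  apply: contrapT => H; apply: nrefl; apply/seteqP; split=> // F _.
  by apply: contrapT => Fx; apply: H; exists F => x FE; apply: Fx; exists x.
have [d d0 Fd] : exists2 d : R, 0 < d & forall x, d <= `|F - can x|.
  apply: contrapT => H; have [d d0|x] := @canonical_embedding_closed F; last exact: Fx.
  apply: contrapT => H'; apply: H; exists d => // x; rewrite leNgt; apply/negP => xd.
  by apply: H'; exists x.
have F0 : 0 < `|F|.
  have := Fd 0; rewrite (_ : can 0 = 0) ?subr0; first exact: lt_le_trans.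
  by apply: functional_ext => f /=; rewrite linear0.
(* As [F] is at least [d / 2] on the midpoint hull, its elements have norm at least [2 * rho]; a
   point norming one of them up to [rho] still gives the value [rho]. *)
pose rho : R := d / 2 / `|F| / 2.
have rho0 : 0 < rho by rewrite !divr_gt0.
pose pick E := sval (cid (annihilator_far E d0 Fd)).
have pick1 E : `|pick E| <= 1 by have [] := svalP (cid (annihilator_far E d0 Fd)).
have pickE E x : x \in E -> pick E x = 0.
  by have [_ + _] := svalP (cid (annihilator_far E d0 Fd)); apply.
have pickF E : d / 2 <= F (pick E) by have [] := svalP (cid (annihilator_far E d0 Fd)).
pose pt (g : 'L(X, R)) := sval (cid2 (functional_norm_adherent g rho0)).
have pt1 g : `|pt g| <= 1 by rewrite /pt; case: cid2.
have ptP (g : 'L(X, R)) : `|g| - rho < g (pt g) by rewrite /pt; case: cid2.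
(* A stage holds the midpoint combinations formed so far and points norming them up to [rho]; the
   next functional vanishes on these points. *)
pose stage := fix stage n : seq 'L(X, R) * seq X :=
  if n is m.+1 then
    let: (G, E) := stage m in
    let G' := pick E :: G ++ [seq 2^-1 *: (g + g') | g <- G, g' <- G] in
    (G', E ++ map pt G')
  else ([::], [::]).
pose G n := (stage n).1; pose E n := (stage n).2; pose f n := pick (E n).
have GS n : G n.+1 = f n :: G n ++ [seq 2^-1 *: (g + g') | g <- G n, g' <- G n].
  by rewrite /G /f /E /=; case: (stage n).
have ES n : E n.+1 = E n ++ map pt (G n.+1).
  by rewrite /G /E /=; case: (stage n).
have Gmono m n : (m <= n)%N -> {subset G m <= G n}.
  move=> /subnKC <-; elim: (n - m)%N => [|k IH]; rewrite ?addn0// addnS => g /IH gG.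
  by rewrite GS inE mem_cat gG orbT.
have Emono m n : (m <= n)%N -> {subset E m <= E n}.
  move=> /subnKC <-; elim: (n - m)%N => [|k IH]; rewrite ?addn0// addnS => x /IH xE.
  by rewrite ES mem_cat xE.
have hullG g : mid_hull (range f) g -> exists n, g \in G n.+1.
  elim=> [_ [n _ <-]|u v _ [m um] _ [n vn]]; first by exists n; rewrite GS mem_head.
  exists (maxn m n).+1; rewrite GS inE mem_cat; apply/orP; right; apply/orP; right.
  apply/allpairsP; exists (u, v); split=> //=.
    by apply: Gmono um; rewrite ltnS leq_maxl.
  by apply: Gmono vn; rewrite ltnS leq_maxr.
have hullF g : mid_hull (range f) g -> d / 2 <= F g.
  elim=> [_ [n _ <-]|u v _ Fu _ Fv]; first exact: pickF.
  rewrite linearZ linearD [leRHS]mulrC; lra.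
have f1 n : `|f n| <= 1 by exact: pick1.
have hull1 g : mid_hull (range f) g -> `|g| <= 1.
  by apply: mid_hull_norm => _ [n _ <-]; exact: f1.
have [B [h [B0 BS Bge Bh]]] := nested_limit f1 sc.
have h1 : `|h| <= 1.
  apply: functional_norm_le => x x1; apply/ler_addgt0Pr => e e0.
  have [n Bn] := Bh x e e0; have [m Bm] := B0 n.
  have := Bn m Bm; have := le_trans (functional_le (f m) x1) (f1 m).
  rewrite !ler_norml; lra.
have hE n x : x \in E n -> h x = 0.
  move=> xE; apply/eqP; rewrite -normr_le0; apply/ler_addgt0Pr => e e0.
  have [k Bk] := Bh x e e0; have [m Bm] := B0 (maxn k n).
  have Bdec i j : (i <= j)%N -> B j `<=` B i.
    move=> /subnKC <-; elim: (j - i)%N => [|l IH]; rewrite ?addn0//.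
    by rewrite addnS => y /BS/IH.
  have := Bk m (Bdec _ _ (leq_maxl k n) _ Bm).
  rewrite /f pickE ?sub0r ?normrN ?add0r//; apply: Emono xE.
  by apply: leq_trans (Bge _ _ Bm); exact: leq_maxr.
have far g : mid_hull (range f) g -> rho <= `|g - h|.
  move=> hg; have [n gn] := hullG _ hg.
  have := functional_le (g - h) (pt1 g); rewrite functionalDE functionalNE.
  rewrite (@hE n.+1); last by rewrite ES mem_cat (map_f pt gn) orbT.
  have : d / 2 <= `|F| * `|g|.
    by rewrite (le_trans (hullF _ hg))// (le_trans (ler_norm _))// operator_norm_le.
  rewrite -ler_pdivrMl// => g_ge.
  have := ptP g; rewrite /rho ler_norml; lra.
have hullB n g : mid_hull (f @` B n) g -> mid_hull (range f) g.
  by apply: mid_hull_sub => _ [m _ <-]; exists m.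
(* The bound 2 comes from [|g| <= 1] and [|h| <= 1]. *)
apply: (@James_not_NA R X (fun n => [set g - h | g in mid_hull (f @` B n)]) 2 rho) => //.
- move=> n; have [m Bm] := B0 n; exists (f m - h), (f m) => //.
  by apply: mid_hull_base; exists m.
- move=> n _ [g hg <-]; exists g => //; apply: mid_hull_sub hg.
  by move=> _ [m /BS Bm <-]; exists m.
- move=> n _ _ [u hu <-] [v hv <-]; exists (2^-1 *: (u + v)).
    exact: mid_hull_mid.
  rewrite addrACA -opprD scalerBr; congr (_ - _).
  by rewrite scalerDr -scalerDl (_ : 2^-1 + 2^-1 = 1) ?scale1r//; lra.
- move=> _ [g /hullB hg <-]; rewrite far//=.
  by rewrite (le_trans (ler_normB _ _))//; have := hull1 _ hg; lra.
- move=> x e e0; have [n Bn] := Bh x e e0; exists n => _ [g hg <-].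
  rewrite functionalDE functionalNE; elim: hg => [_ [m Bm <-]|u v _ hu _ hv].
    exact: Bn.
  by move: hu hv; rewrite functionalZE functionalDE !ler_norml; lra.
Qed.

End bidual.

(** * Bhatia-Semrl properties of functionals *)

Section Bhatia_Semrl_functionals.
Context (R : realType) (X : normedModType R).
Implicit Types (f g : 'L(X, R)) (x u : X).

Lemma strong_BJ_orthogonalW (V : normedModType R) (x y : V) :
  strong_BJ_orthogonal x y -> BJ_orthogonal x y.
Proof.
by move=> xy l; have [->|/xy/ltW//] := eqVneq l 0; rewrite scale0r addr0.
Qed.

Lemma BS_sub_BSa : BS X R `<=` BSa X R.
Proof. by move=> f [fNA fBS]; split=> // g /strong_BJ_orthogonalW/fBS. Qed.

Lemma BJ_orthogonal0 (V : normedModType R) (y : V) : BJ_orthogonal 0 y.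
Proof. by move=> l; rewrite normr0. Qed.

Lemma BJ_orthogonal_real (a b : R) : BJ_orthogonal a b -> a = 0 \/ b = 0.
Proof.
move=> ab; have [->|b0] := eqVneq b 0; [by right|left].
have := ab (- (a / b)); rewrite -[_ *: _]/(_ * _) mulNr divfK// subrr normr0.
by rewrite normr_le0 => /eqP.
Qed.

(** If [f + l *: g] had the norm of [f], orthogonality would keep their midpoint [f + (l / 2) *: g]
    from having smaller norm, so the two would coincide. *)
Lemma BS_strictly_convex : strictly_convex 'L(X, R) -> BS X R = BSa X R.
Proof.
move=> sc; apply/seteqP; split; first exact: BS_sub_BSa.
move=> f [fNA fBSa]; split=> // g fg.
have [f0|f0] := eqVneq f 0.
  by case: fNA => x fx; exists x => //; rewrite f0; exact: BJ_orthogonal0.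
have [g0|g0] := eqVneq g 0.
  by case: fNA => x fx; exists x => // l; rewrite g0 scaler0 addr0.
apply: fBSa => l l0; rewrite lt_neqAle fg andbT; apply/eqP => fl.
have : f = f + l *: g.
  apply: strictly_convex_eq => //.
  rewrite addrA scalerDr !scalerA (_ : 2^-1 *: (f + f) = f); last first.
    by rewrite scalerDr -scalerDl (_ : 2^-1 + 2^-1 = 1) ?scale1r//; lra.
  exact: fg.
by move=> /eqP; rewrite -subr_eq0 opprD addNKr oppr_eq0 scaler_eq0 (negbTE l0) (negbTE g0).
Qed.

(** Together with its opposite this is the whole norm attainment set; for [f != 0] the face alone is
    convex. *)
Definition face f : set X := [set x | `|x| = 1 /\ f x = `|f|].

Lemma face_attain f x : face f x -> norm_attainment_set f x.
Proof. by move=> [x1 fx]; split=> //; rewrite fx normr_id. Qed.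

Lemma attain_face f x : norm_attainment_set f x -> face f x \/ face f (- x).
Proof.
move=> [x1 fx]; have [fx0|fx0] := leP 0 (f x).
  by left; split=> //; rewrite -fx ger0_norm.
by right; split; rewrite ?normrN// linearN -fx ltr0_norm.
Qed.

Lemma face_convex f x y (a b : R) : f != 0 -> 0 <= a -> 0 <= b -> a + b = 1 ->
  face f x -> face f y -> face f (a *: x + b *: y).
Proof.
move=> f0 a0 b0 ab [x1 fx] [y1 fy].
have fxy : f (a *: x + b *: y) = `|f|.
  by rewrite functional_comb fx fy -mulrDl ab mul1r.
split=> //; apply/le_anti/andP; split.
  rewrite (le_trans (ler_normD _ _))// !normrZ x1 y1 !mulr1 !ger0_norm//; lra.
have := operator_norm_le f (a *: x + b *: y); rewrite fxy normr_id.
by rewrite ler_pMr// normr_gt0.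
Qed.

Lemma BSa0 : NA X R 0 -> BSa X R 0.
Proof.
by move=> [x Mx]; split; [exists x|move=> g _; exists x => //; exact: BJ_orthogonal0].
Qed.

(* If [g] had no zero on the face it would have a constant sign there, say
   positive; as the distance to the face is controlled by [`|f| - f u],
   subtracting a small multiple of [g] from [f] does not increase the norm. *)
Lemma BSa_of_face f (K : R) : 0 <= K ->
  (forall u, `|u| <= 1 -> exists2 u', face f u' & `|u - u'| <= K * (`|f| - f u)) ->
  BSa X R f.
Proof.
move=> K0 fK; have [|u0 Fu0 _] := fK 0; first by rewrite normr0.
have fNA : NA X R f by exists u0; exact: face_attain.
have [f0|f0] := eqVneq f 0; first by rewrite f0; apply: BSa0; rewrite -f0.
split=> // g fg; apply: contrapT => none.
have gn0 x : face f x -> g x != 0.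
  move=> Fx; apply/eqP => gx; apply: none; exists x; first exact: face_attain.
  by move=> l; rewrite gx scaler0 addr0.
(* A change of sign would give a zero of [g] on the segment from [x] to [y], which lies in the
   face. *)
have sgn x y : face f x -> face f y -> 0 < g x -> 0 < g y.
  move=> Fx Fy gx; rewrite lt_neqAle eq_sym gn0//= leNgt; apply/negP => gy.
  have d0 : 0 < g x - g y by lra.
  have gz : g (- g y / (g x - g y) *: x + g x / (g x - g y) *: y) = 0.
    by rewrite functional_comb; field; rewrite gt_eqF.
  suff /gn0 : face f (- g y / (g x - g y) *: x + g x / (g x - g y) *: y).
    by rewrite gz eqxx.
  apply: face_convex => //.
  - by rewrite divr_ge0 ?ltW//; lra.
  - by rewrite divr_ge0 ?ltW//; lra.
  - by field; rewrite gt_eqF.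
have [s [s1 sg]] : exists s : R, `|s| = 1 /\ forall x, face f x -> 0 < s * g x.
  have := gn0 _ Fu0; rewrite neq_lt => /orP[gu|gu]; last first.
    by exists 1; rewrite normr1; split=> // x Fx; rewrite mul1r; exact: sgn gu.
  exists (-1); rewrite normrN1; split=> // x Fx; rewrite mulN1r oppr_gt0 ltNge.
  apply/negP => gx; have gx0 : 0 < g x by rewrite lt_neqAle eq_sym gn0.
  by have := sgn _ _ Fx Fu0 gx0; rewrite ltNge ltW.
(* Since [t * K * |g| <= 1], the gain of [- (t * s) *: g] at [u] is at most [|f| - f u]. *)
pose t := (K * `|g| + 1)^-1.
have t0 : 0 < t by rewrite invr_gt0 ltr_wpDl// mulr_ge0.
have tK : t * (K * `|g|) <= 1.
  by rewrite mulrC ler_pdivrMr ?mul1r ?lerDl// ltr_wpDl// mulr_ge0.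
have s0 : s != 0 by rewrite -normr_gt0 s1.
have ts0 : - (t * s) != 0 by rewrite oppr_eq0 mulf_eq0 negb_or (gt_eqF t0).
have := fg _ ts0; apply/negP; rewrite -leNgt; apply: functional_norm_le1 => u u1.
have [u' Fu' uu'] := fK u u1.
rewrite functionalDE functionalZE.
have sgu : - (s * g u) <= `|g| * (K * (`|f| - f u)).
  have H : - (s * (g u - g u')) <= `|g| * `|u - u'|.
    rewrite -linearB (le_trans _ (operator_norm_le _ _))//.
    by rewrite (le_trans (ler_norm _))// normrN normrM s1 mul1r.
  have := ler_wpM2l (normr_ge0 g) uu'; have := sg _ Fu'.
  by move: H; rewrite mulrBr; lra.
have fu : 0 <= `|f| - f u.
  by rewrite subr_ge0 (le_trans (ler_norm _))// functional_le.
have := ler_wpM2l (ltW t0) sgu; have := ler_wpM2r fu tK.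
by move: `|f| `|g| (f u) (g u) => a b c d; lra.
Qed.

(** Where [g] is near 1 on the face, [g - f] is near 0, so no multiple of it lowers the norm of [f];
    yet [g - f] is negative on the whole face. *)
Lemma not_BS f g : `|f| = 1 -> (forall x, face f x -> g x < 1) ->
  (forall e, 0 < e -> exists2 x, face f x & 1 - e <= g x) -> ~ BS X R f.
Proof.
move=> f1 gF gsup [_ /(_ (g - f))[l|x Mx]].
  rewrite f1; apply/ler_addgt0Pr => e e0.
  have l1 : 0 < `|l| + 1 by rewrite ltr_wpDl.
  have [x Fx gx] := gsup _ (divr_gt0 e0 l1); have [x1 fx] := Fx.
  have small : `|l| * (1 - g x) <= e.
    have : (`|l| + 1) * (1 - g x) <= e by rewrite mulrC -ler_pdivlMr//; lra.
    by have := gF _ Fx; lra.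
  have low : - (`|l| * (1 - g x)) <= l * (g x - 1).
    rewrite -mulrN opprB ler_wnM2r//; first by have := gF _ Fx; lra.
    exact: ler_norm.
  have x1' : `|x| <= 1 by rewrite x1.
  have := functional_le (f + l *: (g - f)) x1'.
  rewrite functionalDE functionalZE functionalDE functionalNE fx f1.
  rewrite ler_norml => /andP[_]; lra.
have [Fx|Fx] := attain_face Mx.
  have := gF _ Fx; have [_ fx] := Fx => gx.
  by rewrite functionalDE functionalNE => /BJ_orthogonal_real[]; rewrite fx f1; lra.
have := gF _ Fx; have [_ fx] := Fx => gx; move: fx gx; rewrite !linearN f1 => fx gx.
by rewrite functionalDE functionalNE => /BJ_orthogonal_real[]; lra.
Qed.

(** With [s] the sign of [l] and [e = |l| / 2], the point supplied gives [f + l *: g] a value of at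
    least [1 + |l| / 2]. *)
Lemma not_BSa f g : `|f| = 1 -> (forall x, face f x -> g x != 0) ->
  (forall e s, 0 < e -> `|s| = 1 ->
     exists2 x, `|x| <= 1 & 1 - e <= f x /\ 1 <= s * g x) -> ~ BSa X R f.
Proof.
move=> f1 gF fg [_ /(_ g)[l l0|x Mx]].
  have ln0 : 0 < `|l| by rewrite normr_gt0.
  have s1 : `| l / `|l| | = 1 by rewrite normrM normfV normr_id mulfV ?gt_eqF.
  have e0 : 0 < `|l| / 2 by rewrite divr_gt0.
  have [x x1 [fx gx]] := fg _ _ e0 s1.
  have lg : `|l| <= l * g x.
    by move: gx; rewrite mulrAC ler_pdivlMr ?mul1r.
  have := functional_le (f + l *: g) x1.
  by rewrite functionalDE functionalZE f1 ler_norml => /andP[_]; lra.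
have f0 : f != 0 by rewrite -normr_gt0 f1.
have [Fx|Fx] := attain_face Mx => /BJ_orthogonal_real[fx|gx].
- have [_ fx'] := Fx; have : `|f| = 0 := etrans (esym fx') fx.
  by rewrite f1 => /eqP; rewrite oner_eq0.
- by have /eqP := gF _ Fx; exact.
- have [_] := Fx; rewrite linearN => fx'.
  have : - `|f| = 0 := etrans (congr1 -%R (esym fx')) (etrans (opprK _) fx).
  by rewrite f1 => /eqP; rewrite oppr_eq0 oner_eq0.
- have /eqP := gF _ Fx; rewrite linearN => H; apply: H.
  exact: etrans (congr1 -%R gx) (oppr0 _).
Qed.

End Bhatia_Semrl_functionals.

(** * Dyadic series of functionals *)

Section dyadic_series.
Context (R : realType).
Implicit Types u : nat -> R.

Definition dyadic_sum u N : R := \sum_(i < N) 2^-1 ^+ i.+1 * u i.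

Lemma dyadic_sumS u N :
  dyadic_sum u N.+1 = dyadic_sum u N + 2^-1 ^+ N.+1 * u N.
Proof. exact: big_ord_recr. Qed.

Lemma dyadic_gt0 n : 0 < 2^-1 ^+ n :> R.
Proof. by apply: exprn_gt0; rewrite invr_gt0. Qed.

Lemma dyadicS n : 2^-1 ^+ n.+1 = 2^-1 ^+ n / 2 :> R.
Proof. exact: exprSr. Qed.

Lemma dyadic_small (e : R) : 0 < e -> exists N, 2 * 2^-1 ^+ N <= e.
Proof.
move=> e0; have /cvgrPdist_le/(_ (e / 2)) : 2^-1 ^+ k @[k --> \oo] --> (0 : R).
  by apply: cvg_expr; rewrite gtr0_norm ?invr_gt0// invf_lt1//; lra.
rewrite divr_gt0// => /(_ isT)[N _ /(_ N (leqnn N))].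
by rewrite sub0r normrN gtr0_norm ?dyadic_gt0// => Ne; exists N; lra.
Qed.

Lemma dyadic_sum_tail u N k : (forall i, `|u i| <= 1) ->
  `|dyadic_sum u (N + k) - dyadic_sum u N| <= 2^-1 ^+ N - 2^-1 ^+ (N + k).
Proof.
move=> u1; elim: k => [|k IH]; first by rewrite addn0 !subrr normr0.
rewrite addnS dyadic_sumS addrAC (le_trans (ler_normD _ _))//.
rewrite normrM gtr0_norm ?dyadic_gt0//.
have := ler_wpM2l (ltW (dyadic_gt0 (N + k).+1)) (u1 (N + k)%N).
move: IH; rewrite dyadicS.
move: (2^-1 ^+ N) (2^-1 ^+ (N + k)) `|_ - _| `|u _| => a b c d; lra.
Qed.

Lemma dyadic_sum1 u N : (forall i, (i < N)%N -> u i = 1) ->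
  dyadic_sum u N = 1 - 2^-1 ^+ N.
Proof.
elim: N => [|N IH] u1; first by rewrite /dyadic_sum big_ord0 expr0 subrr.
rewrite dyadic_sumS u1// IH => [|i iN]; last by rewrite u1// ltnW.
by rewrite dyadicS; lra.
Qed.

Lemma dyadic_sum_le u N : (forall i, u i <= 1) -> dyadic_sum u N <= 1 - 2^-1 ^+ N.
Proof.
move=> u1; elim: N => [|N IH]; first by rewrite /dyadic_sum big_ord0 expr0 subrr.
rewrite dyadic_sumS; have := ler_wpM2l (ltW (dyadic_gt0 N.+1)) (u1 N).
by move: IH; rewrite dyadicS; lra.
Qed.

Context (X : normedModType R) (phi : nat -> 'L(X, R)).
Hypothesis phi1 : forall n, `|phi n| <= 1.

(** The sum of the series is taken as an ultrafilter limit of the partial sums; the tail estimate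
    then determines its values. *)
Lemma dyadic_functional : exists G : 'L(X, R), forall x N, `|x| <= 1 ->
  `|G x - dyadic_sum (fun n => phi n x) N| <= 2^-1 ^+ N.
Proof.
pose S N : 'L(X, R) := \sum_(i < N) 2^-1 ^+ i.+1 *: phi i.
have SE N x : S N x = dyadic_sum (fun n => phi n x) N.
  elim: N => [|N IH]; first by rewrite /S /dyadic_sum !big_ord0.
  by rewrite dyadic_sumS -IH /S big_ord_recr.
have phix x i : `|x| <= 1 -> `|phi i x| <= 1.
  by move=> x1; rewrite (le_trans (functional_le _ x1)).
have S1 N : `|S N| <= 1.
  apply: functional_norm_le1 => x x1; rewrite SE.
  have ub i : phi i x <= 1 := le_trans (ler_norm _) (phix _ i x1).
  by have := dyadic_sum_le N ub; have := dyadic_gt0 N; lra.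
have [|U [UU _ Uoo]] := @free_ultrafilter setT; first by move=> N; exists N.
have [G SG] := ultra_functional UU S1; exists G => x N x1.
have GN : `|S i x - S N x| @[i --> U] --> `|G x - S N x|.
  by apply: cvg_norm; apply: cvgB; [exact: SG|exact: cvg_cst].
rewrite -SE; apply: (cvgr_to_le GN); apply: Uoo; exists N => // i /= Ni.
have := @dyadic_sum_tail (fun n => phi n x) N (i - N) (fun n => phix _ n x1).
rewrite !SE subnKC// => /le_trans; apply.
by rewrite lerBlDr lerDl ltW// dyadic_gt0.
Qed.

Context (G : 'L(X, R)).
Hypothesis GE : forall x N, `|x| <= 1 ->
  `|G x - dyadic_sum (fun n => phi n x) N| <= 2^-1 ^+ N.

(** The weights are positive with sum 1 and all values are at most 1, so one smaller value makes the
    sum smaller than 1. *)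
Lemma dyadic_functional_lt1 x n : `|x| <= 1 -> phi n x < 1 -> G x < 1.
Proof.
move=> x1 xn; have phix i : phi i x <= 1.
  rewrite (le_trans (ler_norm _))// (le_trans (functional_le _ x1))//.
have := GE n.+1 x1; rewrite dyadic_sumS ler_norml => /andP[_].
have := dyadic_sum_le n phix; move: xn; rewrite dyadicS; have := dyadic_gt0 n.
move: (2^-1 ^+ n) (dyadic_sum _ n) (G x) (phi n x) => a b c d a0 d1 ba.
suff : 0 < a * (1 - d) by lra.
by rewrite mulr_gt0// subr_gt0.
Qed.

Lemma dyadic_functional_ge x N : `|x| <= 1 ->
  (forall i, (i < N)%N -> phi i x = 1) -> 1 - 2 * 2^-1 ^+ N <= G x.
Proof.
move=> x1 xN; have := GE N x1; rewrite dyadic_sum1// ler_norml.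
by move: (2^-1 ^+ N) => a; lra.
Qed.

Lemma dyadic_functional_norm : (forall N, exists2 x, `|x| <= 1 &
  forall i, (i < N)%N -> phi i x = 1) -> `|G| = 1.
Proof.
move=> Gx; apply/le_anti/andP; split.
  apply: functional_norm_le => x x1; have := GE 0 x1.
  by rewrite /dyadic_sum big_ord0 subr0 expr0.
apply/ler_addgt0Pr => e e0.
have [N Ne] := dyadic_small e0; have [x x1 xN] := Gx N.
have := dyadic_functional_ge x1 xN; have := functional_le G x1.
by rewrite ler_norml => /andP[_]; lra.
Qed.

End dyadic_series.

(** * The space c0 *)

Section c0_functionals.
Context (R : realType).
Notation c0 := (c0 R).
Implicit Types (u v x : c0) (f : 'L(c0, R)).

Lemma c0_coord_le u n : `|u n| <= `|u|.
Proof.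
apply: (@sup_norm_ge R nat R setT u n) => //.
have /set_mem/= u0 := valP u.
have /cvg_seq_bounded : cvgn (u : nat -> R) by apply/cvg_ex; exists 0.
by move=> /pinfty_ex_gt0[M _ uM]; exists M => k _; exact: uM.
Qed.

Lemma c0_norm_le u (M : R) : (forall n, `|u n| <= M) -> `|u| <= M.
Proof. by move=> uM; apply: sup_norm_le => //; exists 0%N. Qed.

Lemma c0_coordD u v n : (u + v) n = u n + v n. Proof. by []. Qed.
Lemma c0_coordN u n : (- u) n = - u n. Proof. by []. Qed.
Lemma c0_coordZ (a : R) u n : (a *: u) n = a * u n. Proof. by []. Qed.

Lemma c0_modify (w : nat -> R) u N : (forall n, (N <= n)%N -> w n = u n) ->
  exists v, v = w :> (nat -> R).
Proof.
move=> wu; have w0 : w \in @is_c0 R.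
  apply/mem_set => /=; have /set_mem/= u0 := valP u.
  by apply: cvg_trans u0; apply: near_eq_cvg; exists N => // n /wu ->.
by exists (C0 w0).
Qed.

Lemma c0_small u (e : R) : 0 < e -> exists N, forall n, (N <= n)%N -> `|u n| <= e.
Proof.
move=> e0; have /set_mem/= /cvgrPdist_le/(_ e e0)[N _ uN] := valP u.
by exists N => n /uN; rewrite sub0r normrN.
Qed.

Lemma coord_fun_exists n : exists F : 'L(c0, R), forall u, F u = u n.
Proof.
have [//|u|F FE] := @functional_of_bounded R c0 (fun u => u n) 1.
  by rewrite mul1r c0_coord_le.
by exists F => u; rewrite FE.
Qed.

Definition coord_fun n : 'L(c0, R) := sval (cid (coord_fun_exists n)).

Lemma coord_funE n u : coord_fun n u = u n.
Proof. exact: (svalP (cid (coord_fun_exists n))). Qed.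

Lemma coord_fun_norm n : `|coord_fun n| <= 1.
Proof.
apply: functional_norm_le => u u1; rewrite coord_funE.
by rewrite (le_trans (c0_coord_le u n)).
Qed.

Lemma c0_basis : exists d : nat -> c0, forall m n, d m n = (m == n)%:R.
Proof.
have dm m : exists v, v = (fun n => (m == n)%:R) :> (nat -> R).
  by apply: (@c0_modify _ 0 m.+1) => n mn; rewrite ltn_eqF.
exists (fun m => sval (cid (dm m))) => m n.
by rewrite (svalP (cid (dm m))).
Qed.

Lemma c0_sum I (r : seq I) (F : I -> c0) n :
  (\sum_(i <- r) F i) n = \sum_(i <- r) F i n.
Proof. by elim/big_rec2: _ => // i y z _ <-. Qed.

(* On the infinitely many coordinates where a norming vector is at most 1/2 it
   can be perturbed in both directions, so the functional vanishes there. *)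
Lemma NA_c0_tail f : NA c0 R f ->
  exists N, forall v, (forall n, (n < N)%N -> v n = 0) -> f v = 0.
Proof.
move=> [x Mx].
have {x Mx} [x [x1 fx]] : face f !=set0.
  by have [Fx|Fx] := attain_face Mx; [exists x|exists (- x)].
have h0 : 0 < 1 / 2 :> R by rewrite divr_gt0.
have [N xN] := c0_small x h0.
exists N => v vN.
have key (w : c0) : (forall n, (n < N)%N -> w n = 0) -> `|w| <= 1 / 2 -> f w <= 0.
  move=> wN w2; have xw1 : `|x + w| <= 1.
    apply: c0_norm_le => n; rewrite c0_coordD.
    have [nN|nN] := ltnP n N.
      by rewrite wN// addr0 -x1 c0_coord_le.
    rewrite (le_trans (ler_normD _ _))//.
    by have := xN _ nN; have := le_trans (c0_coord_le w n) w2; lra.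
  have := functional_le f xw1; rewrite linearD/= fx ler_norml => /andP[_].
  by rewrite gerDl.
have v0 : 0 < (`|v| + 1) * 2 by rewrite mulr_gt0// ltr_wpDl.
pose t := ((`|v| + 1) * 2)^-1.
have t0 : 0 < t by rewrite invr_gt0.
have tv : `|t *: v| <= 1 / 2.
  rewrite normrZ gtr0_norm// mulrC ler_pdivrMr//.
  by have := normr_ge0 v; lra.
have Z1 : f (t *: v) <= 0.
  by apply: key => // n nN; rewrite c0_coordZ vN// mulr0.
have Z2 : f (- (t *: v)) <= 0.
  apply: key; last by rewrite normrN.
  by move=> n nN; rewrite c0_coordN c0_coordZ vN// mulr0 oppr0.
have tf : f (t *: v) = t * f v by rewrite linearZ.
move: Z1 Z2; rewrite linearN/= tf oppr_le0 => Z1 Z2.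
have /eqP : t * f v = 0 by apply/le_anti; rewrite Z1 Z2.
by rewrite mulf_eq0 gt_eqF//= => /eqP.
Qed.

(** Here [f] is a finite sum of terms [u i * a i]. Replacing [u i] by the sign of [a i] wherever
    [a i] is nonzero moves [u] into the face, and changes coordinate [i] by at most
    [(|f| - f u) / |a i|]. *)
Lemma NA_sub_BSa_c0 : NA c0 R `<=` BSa c0 R.
Proof.
move=> f fNA; have [f0|f0] := eqVneq f 0; first by rewrite f0; apply: BSa0; rewrite -f0.
have [N fN] := NA_c0_tail fNA.
have [d dE] := c0_basis; pose a n := f (d n).
have fE u : f u = \sum_(i < N) u i * a i.
  have /eqP : f (u - \sum_(i < N) u i *: d i) = 0.
    apply: fN => n nN; rewrite c0_coordD c0_coordN.
    have -> : (\sum_(i < N) u i *: d i) n = \sum_(i < N) u i * (i == n :> nat)%:R.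
      by rewrite c0_sum; apply: eq_bigr => i _; rewrite -dE.
    rewrite (bigD1 (Ordinal nN))//= eqxx mulr1 big1 ?addr0 ?subrr// => i /eqP iN.
    have [E|] := eqVneq (i : nat) n; last by rewrite mulr0.
    by case: iN; apply: val_inj.
  rewrite linearB subr_eq0 => /eqP ->; rewrite linear_sum/=.
  by apply: eq_bigr => i _; rewrite linearZ.
pose w u n : R := if (n < N)%N && (a n != 0) then Num.sg (a n) else u n.
have wE u : exists v, v = w u :> (nat -> R).
  by apply: (@c0_modify _ u N) => n nN; rewrite /w ltnNge nN.
have aw u v i : v = w u :> (nat -> R) -> (i < N)%N -> v i * a i = `|a i|.
  move=> -> iN; rewrite /w iN /=; case: eqVneq => [->|ai]; first by rewrite mulr0 normr0.
  by rewrite normrEsg.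


have w1 u v : `|u| <= 1 -> v = w u :> (nat -> R) -> `|v| <= 1.
  move=> u1 vw; apply: c0_norm_le => n; rewrite vw /w; case: ifP => _.
    by rewrite normr_sg; case: (_ != _); rewrite ?ler01 ?lexx.
  exact: le_trans (c0_coord_le u n) u1.
have fv u v : v = w u :> (nat -> R) -> f v = \sum_(i < N) `|a i|.
  by move=> vw; rewrite fE; apply: eq_bigr => i _; rewrite (aw _ _ _ vw).
have ub u i : `|u| <= 1 -> u i * a i <= `|a i|.
  move=> u1; rewrite (le_trans (ler_norm _))// normrM ler_piMl//.
  exact: le_trans (c0_coord_le u i) u1.
have fnorm : `|f| = \sum_(i < N) `|a i|.
  apply/le_anti/andP; split.
    by apply: functional_norm_le1 => u u1; rewrite fE ler_sum// => i _; exact: ub.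
  have [v vw] := wE 0; have v1 := w1 0 v.
  rewrite -(fv _ _ vw) (le_trans (ler_norm _))// functional_le// v1//.
  by rewrite normr0 ler01.
(* Vanishing [a i] contribute 0, since [0^-1 = 0]. *)
pose K := \sum_(i < N) `|a i|^-1.
have K0 : 0 <= K by rewrite sumr_ge0// => i _; rewrite invr_ge0.
apply: (@BSa_of_face _ _ f K) => // u u1.
have [v vw] := wE u; exists v.
  split; last by rewrite (fv _ _ vw) fnorm.
  apply/le_anti; rewrite (w1 u)//=.
  have := operator_norm_le f v; rewrite (fv _ _ vw) -fnorm normr_id.
  by rewrite ler_pMr// normr_gt0.
have gap0 i : 0 <= `|a i| - u i * a i by rewrite subr_ge0 ub.
have gapE : `|f| - f u = \sum_(i < N) (`|a i| - u i * a i).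
  by rewrite fnorm fE sumrB.
have fu0 : 0 <= `|f| - f u by rewrite gapE sumr_ge0.
apply: c0_norm_le => n; rewrite c0_coordD c0_coordN vw /w.
case: ifPn => [/andP[nN an]|_]; last by rewrite subrr normr0 mulr_ge0.
have a0 : 0 < `|a n| by rewrite normr_gt0.
(* The left side is one of the nonnegative summands of [|f| - f u]. *)
have le1 : `|a n| * `|u n - Num.sg (a n)| <= `|f| - f u.
  rewrite -normrM mulrBr (mulrC _ (Num.sg _)) -normrEsg distrC mulrC ger0_norm//.
  by rewrite gapE (bigD1 (Ordinal nN))//= lerDl sumr_ge0.
apply: (@le_trans _ _ (`|a n|^-1 * (`|f| - f u))).
  by rewrite ler_pdivlMl.
by rewrite ler_wpM2r// /K (bigD1 (Ordinal nN))//= lerDl sumr_ge0.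
Qed.

(** On the face of coordinate 0, the dyadic sum of the later coordinates has supremum 1, approached
    by [(1, ..., 1, 0, ...)], but it is not attained as coordinates tend to 0. *)
Lemma BSa_neq_BS_c0 : exists f, BSa c0 R f /\ ~ BS c0 R f.
Proof.
have test N : exists x : c0, `|x| <= 1 /\ forall n, (n <= N)%N -> x n = 1.
  have [|x xE] := @c0_modify (fun n => (n <= N)%N%:R) 0 N.+1.
    by move=> n Nn; rewrite leqNgt Nn.
  exists x; split; last by move=> n nN; rewrite xE nN.
  by apply: c0_norm_le => n; rewrite xE; case: leqP; rewrite ?normr1 ?normr0 ?lexx ?ler01.
have f1 : `|coord_fun 0| = 1.
  apply/le_anti; rewrite coord_fun_norm/=; have [x [x1 x0]] := test 0.
  by have := functional_le (coord_fun 0) x1; rewrite coord_funE x0// normr1.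
have testF x : `|x| <= 1 -> x 0%N = 1 -> face (coord_fun 0) x.
  move=> x1 x0; split; last by rewrite f1 coord_funE.
  by apply/le_anti; rewrite x1 -[leLHS]normr1 -x0 c0_coord_le.
have [G GE] := @dyadic_functional R c0 (fun n => coord_fun n.+1) (fun n => coord_fun_norm n.+1).
exists (coord_fun 0); split.
  apply: NA_sub_BSa_c0; have [x [x1 x0]] := test 0.
  by exists x; apply: face_attain; apply: testF => //; exact: x0.
apply: (@not_BS _ _ _ G) => // [x [x1 _]|e e0].
  have h0 : 0 < 1 / 2 :> R by rewrite divr_gt0.
  have [N xN] := c0_small x h0.
  apply: (dyadic_functional_lt1 (fun n => coord_fun_norm n.+1) GE (n := N)); first by rewrite x1.
  rewrite coord_funE; have := xN N.+1 (leqnSn N); rewrite ler_norml; lra.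
have [N Ne] := dyadic_small e0; have [x [x1 xN]] := test N.
exists x; first by apply: testF => //; exact: xN.
rewrite (le_trans _ (dyadic_functional_ge GE x1 (N := N) _))//; first lra.
by move=> i iN; rewrite coord_funE xN.
Qed.

End c0_functionals.

(** * The space C[0,1] *)

Section C01_functionals.
Context (R : realType).
Notation C01 := (C01 R).
Notation I01 := (unit_interval R).
Implicit Types (u v x : C01) (s t : I01).

Lemma C01_eval_le u t : `|u t| <= `|u|.
Proof.
apply: (@sup_norm_ge R I01 R setT u t) => //.
have /set_mem/= cu := valP u.
move/subspace_valL_continuousP : cu => /continuous_compact cu.
have /cu : compact I01 by exact: segment_compact.
move=> /compact_bounded/pinfty_ex_gt0[M _ uM]; exists M => s _.
have := uM (u s); apply; exists (val s); first exact: set_mem (valP s).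
by have /(congr1 (@^~ s)) := valLK point (u : I01 -> R).
Qed.

Lemma C01_norm_le u (M : R) : (forall t, `|u t| <= M) -> `|u| <= M.
Proof.
move=> uM; apply: sup_norm_le => //.
suff z : 0 \in I01 by exists (exist _ 0 z).
by apply/mem_set; rewrite /unit_interval/= in_itv/= lexx ler01.
Qed.

Lemma C01_evalD u v t : (u + v) t = u t + v t. Proof. by []. Qed.
Lemma C01_evalN u t : (- u) t = - u t. Proof. by []. Qed.

Lemma C01_of_continuous (g : I01 -> R) : continuous g ->
  exists u, u = g :> (I01 -> R).
Proof.
by move=> cg; have Cg : g \in @is_C01 R by [apply/mem_set]; exists (MkC01 Cg).
Qed.

Lemma delta_exists t : exists F : 'L(C01, R), forall u, F u = u t.
Proof.
have [//|u|F FE] := @functional_of_bounded R C01 (fun u => u t) 1.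
  by rewrite mul1r C01_eval_le.
by exists F => u; rewrite FE.
Qed.

Definition delta t : 'L(C01, R) := sval (cid (delta_exists t)).

Lemma deltaE t u : delta t u = u t.
Proof. exact: (svalP (cid (delta_exists t))). Qed.

Lemma delta_norm t : `|delta t| <= 1.
Proof.
apply: functional_norm_le => u u1; rewrite deltaE.
by rewrite (le_trans (C01_eval_le u t)).
Qed.

Lemma mem_I01 (r : R) : 0 <= r <= 1 -> r \in I01.
Proof. by move=> r01; apply/mem_set; rewrite /unit_interval/= in_itv. Qed.

Lemma I01_bounds t : 0 <= val t <= 1.
Proof. by have := set_mem (valP t); rewrite /unit_interval/= in_itv. Qed.

Definition I01_0 : I01 := exist _ 0 (mem_I01 (introT andP (conj (lexx 0) ler01))).

Lemma natSinv_01 n : 0 <= (n.+1%:R^-1 : R) <= 1.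
Proof. by rewrite invr_ge0 ler0n/= invf_le1 ?ltr0n// ler1n. Qed.

Definition I01_inv n : I01 := exist _ n.+1%:R^-1 (mem_I01 (natSinv_01 n)).

Lemma C01_near0 u (e : R) : 0 < e -> exists n, `|u I01_0 - u (I01_inv n)| <= e.
Proof.
move=> e0; have /set_mem/= cu := valP u.
have /cvgrPdist_le/(_ e e0)/nbhs_ballP[d /= d0 ud] := cu I01_0.
have [N _ /(_ N (leqnn N)) Nd] := near_infty_natSinv_lt (PosNum d0).
exists N; apply: ud; suff : ball (0 : R) d N.+1%:R^-1 by [].
by rewrite -ball_normE /= sub0r normrN gtr0_norm// invr_gt0.
Qed.

Lemma C01_comp (h : R -> R) (g : I01 -> R) : continuous h -> continuous g ->
  exists u, u = h \o g :> (I01 -> R).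
Proof.
move=> ch cg; apply: C01_of_continuous => t.
by apply: continuous_comp; [exact: cg|exact: ch].
Qed.

Lemma affine_min1_continuous (a b : R) :
  continuous (fun r : R => Num.min 1 (a * r + b)).
Proof.
move=> r; apply: (@continuous_min R R (fun=> 1) (fun r => a * r + b)); first exact: cst_continuous.
by apply: cvgD; [apply: cvgMl_tmp; exact: cvg_id|exact: cvg_cst].
Qed.

(* equal to -1 at 0 and to 1 on [1/(m+1), 1] *)
Lemma C01_ramp m : exists v, `|v| <= 1 /\ v I01_0 = -1 /\
  forall n, (n <= m)%N -> v (I01_inv n) = 1.
Proof.
have [v vE] := C01_comp (@affine_min1_continuous (2 * m.+1%:R) (-1))
  (@initial_continuous I01 R set_val).
exists v; split; last split.
- apply: C01_norm_le => t; rewrite vE /= ler_norml ge_min lexx/= andbT le_min.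
  have /andP[t0 _] := I01_bounds t.
  have : 0 <= 2 * m.+1%:R * val t by rewrite !mulr_ge0.
  by move: (2 * m.+1%:R * _) => z ?; apply/andP; split; lra.
- by rewrite vE /= mulr0 add0r; apply/min_idPr; lra.
- move=> n nm; rewrite vE /=; apply/min_idPl.
  rewrite lerBrDr -[1 + 1]/(2%:R : R) -mulrA ler_peMr// ler_pdivlMr ?ltr0n//.
  by rewrite mul1r ler_nat.
Qed.

Lemma C01_one : exists v, forall t, v t = 1.
Proof.
have [|v vE] := @C01_of_continuous (fun=> 1); first exact: cst_continuous.
by exists v => t; rewrite vE.
Qed.

Lemma delta0_norm : `|delta I01_0| = 1.
Proof.
apply/le_anti; rewrite delta_norm/=; have [v v1] := C01_one.
have : `|v| <= 1 by apply: C01_norm_le => t; rewrite v1 normr1.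
by move=> /(functional_le (delta I01_0)); rewrite deltaE v1 normr1.
Qed.

Lemma delta0_BSa : BSa C01 R (delta I01_0).
Proof.
apply: (@BSa_of_face _ _ _ 1) => // u u1.
rewrite delta0_norm deltaE mul1r.
have ub t : -1 <= u t <= 1 by rewrite -ler_norml (le_trans (C01_eval_le u t)).
pose c := 1 - u I01_0.
have c0 : 0 <= c by have := ub I01_0; rewrite /c; lra.
(* Raising [u] by its defect [c] at 0 and truncating at 1 gives a point of the face within [c] of
   [u]. *)
have [v vE'] := C01_comp (@affine_min1_continuous 1 c) (set_mem (valP u)).
have vE t : v t = Num.min 1 (u t + c) by rewrite vE' /= mul1r.
have v0 : v I01_0 = 1 by rewrite vE /c addrC subrK; apply/min_idPl.
have v1 : `|v| <= 1.
  apply: C01_norm_le => t; rewrite vE ler_norml ge_min lexx/= andbT le_min.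
  by have := ub t; move=> /andP[? ?]; apply/andP; split; lra.
exists v.
  split; last by rewrite deltaE delta0_norm.
  by apply/le_anti; rewrite v1 -[leLHS]normr1 -v0 C01_eval_le.
apply: C01_norm_le => t; rewrite C01_evalD C01_evalN vE -/c.
by have := ub t; case: (leP 1 (u t + c)) => ?; rewrite ler_norml; lra.
Qed.

(** Against [delta_0], take [G] to be minus the dyadic sum of evaluations at [1/(n+1)]: functions
    equal to 1 at 0 and falling steeply to -1 bring it near 1, while continuity at 0 prevents the
    value 1. *)
Lemma BSa_neq_BS_C01 : exists f, BSa C01 R f /\ ~ BS C01 R f.
Proof.
have phi1 n : `|- delta (I01_inv n)| <= 1 by rewrite normrN delta_norm.
have [G GE] := dyadic_functional phi1.
exists (delta I01_0); split; first exact: delta0_BSa.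
apply: (@not_BS _ _ _ G) => [|x [x1]|e e0]; first exact: delta0_norm.
  rewrite deltaE delta0_norm => x0.
  have [n xn] := C01_near0 x (ltr01 : 0 < 1 :> R).
  apply: (dyadic_functional_lt1 phi1 GE (n := n)); first by rewrite x1.
  by move: xn; rewrite functionalNE deltaE x0 ler_norml; lra.
have [N Ne] := dyadic_small e0; have [v [v1 [v0 vN]]] := C01_ramp N.
exists (- v).
  split; last by rewrite deltaE C01_evalN v0 opprK delta0_norm.
  rewrite normrN; apply/le_anti; rewrite v1 -[leLHS]normrN1 -v0.
  exact: C01_eval_le.
rewrite (le_trans _ (dyadic_functional_ge GE _ (N := N) _)) ?normrN//; first lra.
by move=> i iN; rewrite functionalNE deltaE C01_evalN opprK vN// ltnW.
Qed.

(** A function in the face of [G] equals 1 at all points [1/(n+1)], hence does not vanish at 0; but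
    prescribing 1 at finitely many of these points leaves both values 1 and -1 possible at 0. *)
Lemma NA_neq_BSa_C01 : exists f, NA C01 R f /\ ~ BSa C01 R f.
Proof.
have phi1 n : `|delta (I01_inv n)| <= 1 by exact: delta_norm.
have [G GE] := dyadic_functional phi1.
have [v vt] := C01_one.
have v1 : `|v| <= 1 by apply: C01_norm_le => t; rewrite vt normr1.
have G1 : `|G| = 1.
  by apply: (dyadic_functional_norm GE) => N; exists v => // i _; rewrite deltaE.
exists G; split.
  exists v; split.
    by apply/le_anti; rewrite v1 -[leLHS]normr1 -(vt I01_0) C01_eval_le.
  rewrite G1; apply/le_anti/andP; split.
    by rewrite (le_trans (functional_le _ v1))// G1.
  apply/ler_addgt0Pr => e /dyadic_small[N Ne].
  have := dyadic_functional_ge GE v1 (N := N) (fun i _ => etrans (deltaE _ _) (vt _)).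
  by have := ler_norm (G v); lra.
apply: (@not_BSa _ _ _ (delta I01_0)) => // [x [x1 Gx]|e s e0 s1].
  rewrite deltaE; apply/eqP => x0.
  have [n xn] := C01_near0 x (divr_gt0 ltr01 (ltr0Sn R 1)).
  have : G x < 1.
    apply: (dyadic_functional_lt1 phi1 GE (n := n)); first by rewrite x1.
    by move: xn; rewrite deltaE x0 ler_norml; lra.
  by rewrite Gx G1 ltxx.
have [N Ne] := dyadic_small e0.
have : exists w : C01, [/\ `|w| <= 1, (forall n, (n < N)%N -> w (I01_inv n) = 1) &
    s * w I01_0 = 1].
  have : s = 1 \/ s = -1.
    have [s0|s0] := leP 0 s; [left|right]; first by rewrite -s1 ger0_norm.
    by apply: oppr_inj; rewrite opprK -s1 ltr0_norm.
  case=> ->; first by exists v; split=> //; rewrite vt mul1r.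
  have [w [w1 [w0 wN]]] := C01_ramp N; exists w; split=> // [n nN|].
    by rewrite wN// ltnW.
  by rewrite w0 mulrNN mul1r.
move=> [w [w1 wN w0]]; exists w => //; split; last by rewrite deltaE w0.
rewrite (le_trans _ (dyadic_functional_ge GE w1 (N := N) _))//; first lra.
by move=> i iN; rewrite deltaE wN.
Qed.

End C01_functionals.

(** * The space L1[0,1] *)

Section L1_functionals.
Context (R : realType).
Notation mu := (lebesgue_measure01 R).
Notation L1 := (L1_01 R).
Implicit Types (x y u : L1) (h k phi : measurableTypeR R -> R).

Definition L1_fun x : measurableTypeR R -> R := (x : LspaceType1 mu).

Lemma L1_measurable x : measurable_fun setT (L1_fun x).
Proof.
exact: (@measurable_funPT _ _ _ _
  (repr (x : {mfun_ mu, measurableTypeR R >-> measurableTypeR R}))).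
Qed.

Lemma L1_integrable x : mu.-integrable setT (EFin \o L1_fun x).
Proof. by apply/Lfun1_integrable; exact: (valP (Lspace_repr (x : LspaceType1 mu))). Qed.

Lemma L1_normE x : `|x| = \int[mu]_t `|L1_fun x t|.
Proof. by rewrite -[LHS]/(Lspace_norm (x : LspaceType1 mu)) /Lspace_norm Lnorm1. Qed.

Lemma L1_addE x y : {ae mu, forall t, L1_fun (x + y) t = L1_fun x t + L1_fun y t}.
Proof.
by apply: filterS (Lspace_class_ae (Lspace_repr (x : LspaceType1 mu) +
  Lspace_repr (y : LspaceType1 mu))) => t /(_ I).
Qed.

Lemma L1_scaleE (a : R) x : {ae mu, forall t, L1_fun (a *: x) t = a * L1_fun x t}.
Proof.
by apply: filterS (Lspace_class_ae (a *: Lspace_repr (x : LspaceType1 mu))) => t /(_ I).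
Qed.

Lemma L1_of_integrable h : mu.-integrable setT (EFin \o h) ->
  exists x, {ae mu, forall t, L1_fun x t = h t}.
Proof.
move=> /Lfun1_integrable hL.
exists (Lspace_class (Lfun_Sub (@lexx _ _ 1%E) hL)).
by apply: filterS (Lspace_class_ae (Lfun_Sub (@lexx _ _ 1%E) hL)) => t /(_ I).
Qed.

Lemma Rintegral_ae h k : measurable_fun setT h -> measurable_fun setT k ->
  {ae mu, forall t, h t = k t} -> \int[mu]_t h t = \int[mu]_t k t.
Proof.
move=> mh mk hk; congr fine; apply: ae_eq_integral => //.
- exact/measurable_EFinP.
- exact/measurable_EFinP.
- by apply: filterS hk => t -> _.
Qed.

Lemma Rintegral_ae0 h : mu.-integrable setT (EFin \o h) -> (forall t, 0 <= h t) ->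
  \int[mu]_t h t <= 0 -> {ae mu, forall t, h t = 0}.
Proof.
move=> ih h0 hi.
have [+ _] := @ae_eq_integral_abs _ _ _ mu setT measurableT (EFin \o h) (measurable_int _ ih).
have -> : (\int[mu]_t `|(EFin \o h) t| = \int[mu]_t (h t)%:E)%E.
  by apply: eq_integral => t _ /=; rewrite ger0_norm.
have -> : (\int[mu]_t (h t)%:E = 0)%E.
  rewrite -(fineK (integrable_fin_num measurableT ih)); congr EFin.
  by apply/le_anti; rewrite hi/= fine_ge0// integral_ge0// => t _; rewrite lee_fin.
by move=> /(_ erefl); apply: filterS => t /(_ I)[].
Qed.

Lemma integrable_weight phi h : measurable_fun setT phi -> (forall t, `|phi t| <= 1) ->
  mu.-integrable setT (EFin \o h) -> mu.-integrable setT (EFin \o (fun t => phi t * h t)).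
Proof.
move=> mphi phi1 ih; have /measurable_EFinP mh := measurable_int _ ih.
apply: le_integrable ih => //; first by apply/measurable_EFinP; exact: measurable_funM.
by move=> t _ /=; rewrite lee_fin normrM ler_piMl.
Qed.

Lemma integrable_scale (c : R) h : mu.-integrable setT (EFin \o h) ->
  mu.-integrable setT (EFin \o (fun t => c * h t)).
Proof. by move=> ih; exact: (integrableZl measurableT c ih). Qed.

(** Representatives of the elements of the unit ball of the dual of [L1], bounded everywhere. *)
Definition weight phi := measurable_fun setT phi /\ forall t, `|phi t| <= 1.

Lemma weight_functional phi : weight phi ->
  exists F : 'L(L1, R), `|F| <= 1 /\
    forall x, F x = \int[mu]_t (phi t * L1_fun x t).
Proof.
move=> [mphi phi1].
have iw x := integrable_weight mphi phi1 (L1_integrable x).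
have mw x : measurable_fun setT (fun t => phi t * L1_fun x t).
  by apply: measurable_funM => //; exact: L1_measurable.
have lin a x y : \int[mu]_t (phi t * L1_fun (a *: x + y) t) =
    a * (\int[mu]_t (phi t * L1_fun x t)) + \int[mu]_t (phi t * L1_fun y t).
  have iaw : mu.-integrable setT (EFin \o (fun t => a * (phi t * L1_fun x t))).
    by apply: integrable_scale.
  rewrite -RintegralZl// -RintegralD//; apply: Rintegral_ae => //.
    by apply: measurable_funD => //; apply: measurable_funM.
  apply: filterS2 (L1_addE (a *: x) y) (L1_scaleE a x) => t -> ->.
  by rewrite mulrDr mulrCA.
have bound x : `|\int[mu]_t (phi t * L1_fun x t)| <= 1 * `|x|.
  rewrite mul1r L1_normE (le_trans (le_normr_Rintegral _ _))//.
  apply: le_Rintegral => //.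
  - exact: (integrable_norm (iw x)).
  - exact: (integrable_norm (L1_integrable x)).
  - by move=> t _; rewrite normrM ler_piMl.
have [F FE] := functional_of_bounded lin bound.
exists F; split=> [|x]; last by rewrite FE.
apply: functional_norm_le => x x1; rewrite FE (le_trans (bound x))//.
by rewrite mul1r.
Qed.

Lemma Rintegral_weight_ae phi x h : weight phi -> measurable_fun setT h ->
  {ae mu, forall t, L1_fun x t = h t} ->
  \int[mu]_t (phi t * L1_fun x t) = \int[mu]_t (phi t * h t).
Proof.
move=> [mphi _] mh xh; apply: Rintegral_ae.
- by apply: measurable_funM => //; exact: L1_measurable.
- exact: measurable_funM.
- by apply: filterS xh => t ->.
Qed.

Lemma L1_norm_ae x h : measurable_fun setT h ->
  {ae mu, forall t, L1_fun x t = h t} -> `|x| = \int[mu]_t `|h t|.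
Proof.
move=> mh xh; rewrite L1_normE; apply: Rintegral_ae.
- by apply: measurableT_comp => //; exact: L1_measurable.
- exact: measurableT_comp.
- by apply: filterS xh => t ->.
Qed.

Lemma mu_itv (a b : R) : 0 <= a -> a < b -> b <= 1 -> mu `]a, b] = (b - a)%:E.
Proof.
move=> a0 ab b1; rewrite /lebesgue_measure01 /mrestr (_ : _ `&` _ = `]a, b]%classic).
  by rewrite lebesgue_measure_itv /= lte_fin ab.
apply/seteqP; split=> [t []//|t /= tab]; split=> //.
by move: tab; rewrite /unit_interval/= !in_itv/= => /andP[? ?]; apply/andP; split; lra.
Qed.

Lemma mu_setT : mu setT = 1%E.
Proof.
rewrite /lebesgue_measure01 /mrestr setTI /unit_interval lebesgue_measure_itv/=.
by rewrite lte_fin ltr01 oppr0 adde0.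
Qed.

Lemma ae_pos : {ae mu, forall t : measurableTypeR R, 0 < (t : R)}.
Proof.
exists `]-oo, 0]%classic; split; first exact: measurable_itv.
  rewrite /lebesgue_measure01 /mrestr (_ : _ `&` _ = [set 0]).
    exact: lebesgue_measure_set1.
  apply/seteqP; split=> [t|_ ->]; rewrite /unit_interval/= !in_itv/=.
    by move=> [t0 /andP[t0' _]]; apply/le_anti/andP.
  by rewrite lexx ler01.
by move=> t /= /negP; rewrite -leNgt in_itv.
Qed.

Lemma integrable_cst (c : R) : mu.-integrable setT (EFin \o (fun=> c)).
Proof.
apply: measurable_bounded_integrable => //; first by have := ltry (1 : R); rewrite -mu_setT.
exact: bounded_cst.
Qed.

(** The witness is the normalized indicator of []a, b]]; the factor [s] allows bounds of either
    sign. *)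
Lemma L1_bump (a b : R) : 0 <= a -> a < b -> b <= 1 -> exists x, `|x| = 1 /\
  forall phi (s c : R), weight phi -> (forall t, a < t <= b -> c <= s * phi t) ->
  c <= s * (\int[mu]_t (phi t * L1_fun x t)).
Proof.
move=> a0 ab b1; pose h (t : measurableTypeR R) : R := (b - a)^-1 * \1_(`]a, b]%classic) t.
have ba0 : 0 < b - a by rewrite subr_gt0.
have mab : measurable (`]a, b]%classic : set (measurableTypeR R)) by exact: measurable_itv.
have ii : mu.-integrable setT (EFin \o \1_(`]a, b]%classic : set (measurableTypeR R))).
  apply: (le_integrable measurableT _ _ (integrable_cst 1)).
    by apply/measurable_EFinP; exact: measurable_indic.
  move=> t _ /=; rewrite lee_fin normr1 indicE.
  by case: (_ \in _); rewrite ?normr1 ?normr0 ?lexx ?ler01.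
have ih : mu.-integrable setT (EFin \o h).
  by apply: integrable_scale.
have h0 t : 0 <= h t by rewrite /h mulr_ge0// invr_ge0 ltW.
have hint : \int[mu]_t h t = 1.
  rewrite /h RintegralZl// /Rintegral integral_indic// setIT.
  rewrite [X in fine X](_ : _ = (b - a)%:E); last exact: mu_itv.
  by rewrite /= mulVf// gt_eqF.
have mh : measurable_fun setT h by apply/measurable_EFinP; exact: measurable_int ih.
have [x xh] := L1_of_integrable ih.
exists x; split.
  by rewrite (L1_norm_ae mh xh) -hint; apply: eq_Rintegral => t _; rewrite ger0_norm.
move=> phi s c wphi cphi; have [mphi phi1] := wphi.
have iw := integrable_weight mphi phi1 ih.
rewrite (Rintegral_weight_ae wphi mh xh) -[leLHS]mulr1 -hint -!RintegralZl//.
apply: le_Rintegral => //.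
- by apply: integrable_scale.
- by apply: integrable_scale.
move=> t _; have [tab|tab] := boolP (t \in (`]a, b]%classic : set R)); last first.
  by rewrite /h indicE (negbTE tab) !mulr0.
rewrite mulrA; apply: ler_wpM2r => //; apply: cphi.
by move: tab; rewrite inE/= in_itv.
Qed.

(** The difference of the two sides is nonnegative with integral at most 0. *)
Lemma weight_attained phi x : weight phi -> `|x| <= \int[mu]_t (phi t * L1_fun x t) ->
  {ae mu, forall t, phi t * L1_fun x t = `|L1_fun x t|}.
Proof.
move=> [mphi phi1] xphi; have ix := integrable_norm (L1_integrable x).
have iw := integrable_weight mphi phi1 (L1_integrable x).
have := @Rintegral_ae0 (fun t => `|L1_fun x t| - phi t * L1_fun x t).
move=> H; suff : {ae mu, forall t, `|L1_fun x t| - phi t * L1_fun x t = 0}.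
  by apply: filterS => t /eqP; rewrite subr_eq0 => /eqP.
apply: H.
- by exact: (integrableB measurableT ix iw).
- move=> t; rewrite subr_ge0 (le_trans (ler_norm _))// normrM ler_piMl//.
- by rewrite RintegralB// -L1_normE subr_le0.
Qed.

(** A continuous weight equal to 1 exactly up to [a]: norming elements cannot live beyond [a], yet
    bumps just beyond are nearly norming. *)
Definition ramp (a : R) (t : measurableTypeR R) : R := 1 - Num.min 1 (Num.max 0 (t - a)).

Lemma ramp_bounds a t : 0 <= ramp a t <= 1.
Proof.
by rewrite /ramp; have [?|?] := leP 0 (t - a);
  [have [?|?] := leP 1 (t - a)|have [?|?] := leP (1 : R) 0]; try apply/andP; try split; lra.
Qed.

Lemma ramp_weight a : weight (ramp a).
Proof.
split; last by move=> t; have /andP[? ?] := ramp_bounds a t; rewrite ger0_norm.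
apply: measurable_funB => //; apply: measurable_minr => //.
by apply: measurable_maxr => //; apply: measurable_funB.
Qed.

Lemma ramp_left a t : t <= a -> ramp a t = 1.
Proof.
by move=> ta; rewrite /ramp; have [?|?] := leP 0 (t - a);
  [have [?|?] := leP 1 (t - a)|have [?|?] := leP (1 : R) 0]; lra.
Qed.

Lemma ramp_right a t : a < t -> ramp a t < 1.
Proof.
by move=> ta; rewrite /ramp; have [?|?] := leP 0 (t - a);
  [have [?|?] := leP 1 (t - a)|have [?|?] := leP (1 : R) 0]; lra.
Qed.

Lemma ramp_near a t e : t <= a + e -> 0 <= e -> 1 - e <= ramp a t.
Proof.
by move=> ta e0; rewrite /ramp; have [?|?] := leP 0 (t - a);
  [have [?|?] := leP 1 (t - a)|have [?|?] := leP (1 : R) 0]; lra.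
Qed.

Lemma ramp_attained a x : `|x| <= \int[mu]_t (ramp a t * L1_fun x t) ->
  {ae mu, forall t, (a < t -> L1_fun x t = 0) /\ 0 <= L1_fun x t}.
Proof.
move=> /(weight_attained (ramp_weight a)); apply: filterS => t xt.
have /andP[r0 r1] := ramp_bounds a t.
have x0 : a < t -> L1_fun x t = 0.
  move=> /ramp_right ra; apply/eqP; rewrite -normr_le0 leNgt; apply/negP => xn.
  have := ler_norm (ramp a t * L1_fun x t); rewrite normrM ger0_norm// xt.
  by rewrite ler_pMl// leNgt ra.
split=> //; have [ta|/x0->//] := leP (t : R) a.
by move: xt; rewrite ramp_left// mul1r => ->.
Qed.

End L1_functionals.

(** * Strict inclusions for functionals on [L1[0,1]] *)

Section L1_Bhatia_Semrl.
Context (R : realType).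
Notation mu := (lebesgue_measure01 R).
Notation L1 := (L1_01 R).
Implicit Types (x y u : L1).

Lemma weight_cst1 : weight (fun=> 1 : R).
Proof. by split=> [|t]; [exact: measurable_cst|rewrite normr1]. Qed.

Lemma integral_BSa (f : 'L(L1, R)) : `|f| = 1 ->
  (forall x, f x = \int[mu]_t (1 * L1_fun x t)) -> BSa L1 R f.
Proof.
move=> f1 fE; apply: (@BSa_of_face _ _ _ 1) => // u u1.
rewrite f1 mul1r; have iu := L1_integrable u; have inu := integrable_norm iu.
have fu x : f x = \int[mu]_t L1_fun x t.
  by rewrite fE; apply: eq_Rintegral => t _; rewrite mul1r.
(* This is the positive part of [u]. *)
pose m t : R := 2^-1 * (`|L1_fun u t| + L1_fun u t).
have im : mu.-integrable setT (EFin \o m).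
  by apply: integrable_scale; exact: (integrableD measurableT inu iu).
have m0 t : 0 <= m t.
  by rewrite /m mulr_ge0// -lerBlDr sub0r -normrN ler_norm.
have mu_ t : L1_fun u t <= m t by rewrite /m; have := ler_norm (L1_fun u t); lra.
have m_u t : m t <= `|L1_fun u t| by rewrite /m; have := ler_norm (L1_fun u t); lra.
pose p := \int[mu]_t m t.
have p1 : p <= 1.
  by rewrite (le_trans _ u1)// L1_normE; apply: le_Rintegral.
have ic : mu.-integrable setT (EFin \o (fun=> 1 - p)) by exact: integrable_cst.
have intc : \int[mu]_t (1 - p) = 1 - p.
  by rewrite Rintegral_cst//= [mu _](mu_setT R) /= mulr1.
(* The constant restores integral 1. As [h] dominates [u], its distance to [u] is the integral of
   [h - u], that is [1 - f u]. *)
pose h t : R := m t + (1 - p).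
have ih : mu.-integrable setT (EFin \o h) by exact: (integrableD measurableT im ic).
have h0 t : 0 <= h t by rewrite addr_ge0// subr_ge0.
have hint : \int[mu]_t h t = 1 by rewrite RintegralD// intc -/p addrC subrK.
have mh : measurable_fun setT h by apply/measurable_EFinP; exact: measurable_int ih.
have [x xh] := L1_of_integrable ih.
exists x.
  split.
    rewrite (L1_norm_ae mh xh) -[RHS]hint.
    by apply: eq_Rintegral => t _; rewrite ger0_norm.
  rewrite fE (Rintegral_weight_ae weight_cst1 mh xh) f1 -[RHS]hint.
  by apply: eq_Rintegral => t _; rewrite mul1r.
have uxE : {ae mu, forall t, L1_fun (u - x) t = L1_fun u t - h t}.
  rewrite -scaleN1r.
  apply: filterS3 (L1_addE u (-1 *: x)) (L1_scaleE (-1) x) xh => t -> -> ->.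
  by rewrite mulN1r.
have iuh : mu.-integrable setT (EFin \o (fun t => L1_fun u t - h t)).
  exact: (integrableB measurableT iu ih).
have muh : measurable_fun setT (fun t => L1_fun u t - h t).
  by apply/measurable_EFinP; exact: measurable_int iuh.
rewrite (L1_norm_ae muh uxE).
have -> : 1 - f u = \int[mu]_t (h t - L1_fun u t) by rewrite RintegralB// hint fu.
apply: le_Rintegral => //.
- exact: (integrable_norm iuh).
- exact: (integrableB measurableT ih iu).
by move=> t _; rewrite ler_norml; have := mu_ t; have := h0 t; rewrite /h; lra.
Qed.

(** The weight [ramp 0] is below 1 almost everywhere, so no unit vector gives its functional the
    value 1; nonnegative bumps near 0 approach it. *)
Lemma BSa_neq_BS_L1 : exists f, BSa L1 R f /\ ~ BS L1 R f.
Proof.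
have [f [f1 fE]] := weight_functional weight_cst1.
have [G [G1 GE]] := weight_functional (ramp_weight (0 : R)).
have bump e : 0 < e -> exists x, [/\ `|x| = 1, 1 <= f x & 1 - e <= G x].
  move=> e0; have b1 : Num.min 1 e <= 1 by rewrite ge_min lexx.
  have b0 : 0 < Num.min 1 e by rewrite lt_min ltr01.
  have [x [x1 xphi]] := L1_bump (lexx 0) b0 b1.
  exists x; split=> //.
    by rewrite fE -[leRHS]mul1r; apply: xphi => [|t _]; [exact: weight_cst1|rewrite mulr1].
  rewrite GE -[leRHS]mul1r; apply: xphi => [|t /andP[_ te]]; first exact: ramp_weight.
  rewrite mul1r; apply: ramp_near; last exact: ltW.
  by rewrite add0r (le_trans te)// ge_min lexx orbT.
have fn1 : `|f| = 1.
  apply/le_anti; rewrite f1/=; have [x [x1 fx _]] := bump 1 ltr01.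
  have x1' : `|x| <= 1 by rewrite x1.
  exact: le_trans fx (le_trans (ler_norm _) (functional_le f x1')).
exists f; split; first exact: integral_BSa.
apply: (@not_BS _ _ _ G) => // [x [x1 _]|e e0].
  rewrite ltNge; apply/negP => Gx; have := x1.
  have /ramp_attained xpos : `|x| <= \int[mu]_t (ramp 0 t * L1_fun x t).
    by rewrite x1 -GE.
  have x0 : {ae mu, forall t, L1_fun x t = 0}.
    have xt0 t : 0 < (t : R) -> (0 < t -> L1_fun x t = 0) /\ 0 <= L1_fun x t -> L1_fun x t = 0.
      by move=> t0 [+ _]; apply.
    exact: (@filterS2 _ _ (ae_filter_ringOfSetsType mu) _ _ _ xt0 (ae_pos R) xpos).
  rewrite (@L1_norm_ae R x (fun=> 0) (measurable_cst _) x0) normr0 Rintegral_cst// mul0r.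
  by move=> /eqP; rewrite eq_sym oner_eq0.
have [x [x1 fx Gx]] := bump e e0; exists x => //; split=> //.
apply/le_anti; rewrite fn1 fx andbT.
have x1' : `|x| <= 1 by rewrite x1.
by rewrite (le_trans (ler_norm _))// (le_trans (functional_le f x1'))// fn1.
Qed.

Definition half_sign (t : measurableTypeR R) : R := if t <= 2^-1 then 1 else -1.

Lemma half_sign_weight : weight half_sign.
Proof.
split; last by move=> t; rewrite /half_sign; case: ifP; rewrite ?normrN1 ?normr1.
apply: measurable_fun_ifT => //.
exact: measurable_fun_ler.
Qed.

Lemma NA_neq_BSa_L1 : exists f, NA L1 R f /\ ~ BSa L1 R f.
Proof.
have [f [f1 fE]] := weight_functional (ramp_weight (2^-1 : R)).
have [g [g1 gE]] := weight_functional half_sign_weight.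
have h0 : 0 < 2^-1 :> R by rewrite invr_gt0.
have h1 : 2^-1 <= 1 :> R by rewrite invf_le1// ler1n.
have [x0 [x01 x0phi]] := L1_bump (lexx 0) h0 h1.
have x01' : `|x0| <= 1 by rewrite x01.
have fx0 : 1 <= f x0.
  rewrite fE -[leRHS]mul1r; apply: x0phi => [|t /andP[_ th]]; first exact: ramp_weight.
  by rewrite ramp_left// mul1r.
have gx0 : 1 <= g x0.
  rewrite gE -[leRHS]mul1r; apply: x0phi => [|t /andP[_ th]]; first exact: half_sign_weight.
  by rewrite /half_sign th mul1r.
have fn1 : `|f| = 1.
  apply/le_anti; rewrite f1/=.
  exact: le_trans fx0 (le_trans (ler_norm _) (functional_le f x01')).
exists f; split.
  exists x0; split=> //; apply/le_anti; rewrite functional_le//= fn1.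
  exact: le_trans fx0 (ler_norm _).
apply: (@not_BSa _ _ _ g) => // [x [x1 fx]|e s e0 s1].
  have /ramp_attained xpos : `|x| <= \int[mu]_t (ramp 2^-1 t * L1_fun x t).
    by rewrite x1 -fE fx fn1.
  suff gx : \int[mu]_t (half_sign t * L1_fun x t) = `|x| by rewrite gE gx x1 oner_eq0.
  rewrite L1_normE; apply: Rintegral_ae.
  - by apply: measurable_funM; [exact: half_sign_weight.1|exact: L1_measurable].
  - by apply: measurableT_comp => //; exact: L1_measurable.
  apply: (@filterS _ _ (ae_filter_ringOfSetsType mu) _ _ _ xpos) => t [xt0 xt].
  by rewrite ger0_norm// /half_sign; case: leP => [_|/xt0->]; rewrite ?mul1r ?mulr0.
have [s0|s0] := leP 0 s.
  have -> : s = 1 by rewrite -s1 ger0_norm.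
  by exists x0 => //; rewrite mul1r; split=> //; lra.
have -> : s = -1 by apply: oppr_inj; rewrite opprK -s1 ltr0_norm.
(* A bump on []1/2, b]] has sign -1 throughout, and [ramp 2^-1] is at least [1 - e] there; the
   minimum keeps [b] within [[0,1]]. *)
pose b : R := 2^-1 + Num.min 2^-1 e.
have b0 : 2^-1 < b by rewrite ltrDl lt_min h0.
have b1 : b <= 1.
  have : Num.min 2^-1 e <= 2^-1 by rewrite ge_min lexx.
  by rewrite /b; lra.
have [x [x1 xphi]] := L1_bump (ltW h0) b0 b1.
exists x; first by rewrite x1.
split.
  rewrite fE -[leRHS]mul1r; apply: xphi => [|t /andP[_ te]]; first exact: ramp_weight.
  rewrite mul1r; apply: ramp_near; last exact: ltW.
  by rewrite (le_trans te)// lerD2l ge_min lexx orbT.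
rewrite gE; apply: xphi => [|t /andP[th _]]; first exact: half_sign_weight.
rewrite /half_sign ifF ?mulrNN ?mulr1//; apply/negbTE; rewrite -ltNge; exact: th.
Qed.

End L1_Bhatia_Semrl.

Theorem theorem1p4 (R : realType) :
  (BS (c0 R) R `<` BSa (c0 R) R /\ BSa (c0 R) R = NA (c0 R) R) /\
  (BS (L1_01 R) R `<` BSa (L1_01 R) R /\
     BSa (L1_01 R) R `<` NA (L1_01 R) R) /\
  (BS (C01 R) R `<` BSa (C01 R) R /\ BSa (C01 R) R `<` NA (C01 R) R) /\
  (forall X : completeNormedModType R,
     ~ reflexive_space X -> strictly_convex 'L(X, R) ->
     BS X R = BSa X R /\ BSa X R `<` [set: 'L(X, R)]).
Proof.
have strict (T : Type) (A B : set T) :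
    A `<=` B -> (exists f, B f /\ ~ A f) -> A `<` B.
  by move=> AB [f [Bf Af]]; split=> // /(_ f Bf).
have BSaNA (X : normedModType R) : BSa X R `<=` NA X R by move=> f [].
split; [|split; [|split]].
- split; first exact: strict (@BS_sub_BSa _ _) (BSa_neq_BS_c0 R).
  by apply/seteqP; split; [exact: BSaNA|exact: NA_sub_BSa_c0].
- split; first exact: strict (@BS_sub_BSa _ _) (BSa_neq_BS_L1 R).
  exact: strict (@BSaNA _) (NA_neq_BSa_L1 R).
- split; first exact: strict (@BS_sub_BSa _ _) (BSa_neq_BS_C01 R).
  exact: strict (@BSaNA _) (NA_neq_BSa_C01 R).
- move=> X nrefl sc; split; first exact: BS_strictly_convex.
  apply: strict => //; have [z zNA] := smooth_James sc nrefl.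
  by exists z; split=> // /BSaNA.
Qed.
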